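(* Let $C$ be an $A_\infty$-coalgebra and let $A$ be an $A_\infty$-algebra over $K$. Then a pairing $f=\{f_k:A^{\otimes k}\to C^*\}_{k\ge1}$ between $C$ and $A$ induces a functor $\iota(C,A):\mathbf M^C\to{}_A\mathbf M$ from right $A_\infty$-comodules over $C$ to left $A_\infty$-modules over $A$.
   Context: $K$ is a field; Koszul sign conventions apply. $A_\infty$-algebra: graded space $A$ with maps $m_k:A^{\otimes k}\to A$ of degree $2-k$ ($k\ge1$), $\sum_{p+q+r=n}(-1)^{p+qr}m_{p+1+r}(1^{\otimes p}\otimes m_q\otimes1^{\otimes r})=0$ for $n\ge1$ ($p,r\ge0,q\ge1$). Morphism $f:A\to B$ of $A_\infty$-algebras: maps $f_k:A^{\otimes k}\to B$ of degree $1-k$ with $\sum(-1)^{p+qr}f_{p+1+r}(1^{\otimes p}\otimes m_q\otimes1^{\otimes r})=\sum(-1)^sm_t(f_{i_1}\otimes\dots\otimes f_{i_t})$ for each $n\ge1$, the first sum over $p+q+r=n$, the second over $1\le t\le n$ and $i_1+\dots+i_t=n$, with $s=(t-1)(i_1-1)+(t-2)(i_2-1)+\dots+(i_{t-1}-1)$. Left $A_\infty$-module: graded space $M$ with $m^M_k:A^{\otimes k-1}\otimes M\to M$ of degree $2-k$, $\sum_{p+q+r=n,\,q,r\ge1}(-1)^{p+qr}m^M_{p+1+r}(1^{\otimes p}\otimes m_q\otimes1^{\otimes r-1}\otimes1_M)+\sum_{a+b=n,\,b\ge1}(-1)^am^M_{a+1}(1^{\otimes a}\otimes m_b^M)=0$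 for $n\ge1$. Morphisms in ${}_A\mathbf M$ are degree-preserving maps compatible with all structure maps. $A_\infty$-coalgebra: graded space $C$ with $w_k:C\to C^{\otimes k}$ of degree $2-k$ ($k\ge1$), $\sum_{p+q+r=n}(-1)^{pq+r}(1^{\otimes p}\otimes w_q\otimes1^{\otimes r})w_{p+1+r}=0$ for $n\ge1$ ($p,r\geq 0$, $q\geq 1$), and such that $\prod_kw_k:C\to\prod_kC^{\otimes k}$ factors through $\bigoplus_kC^{\otimes k}$. Right $A_\infty$-comodule: graded space $P$ with $w^P_k:P\to P\otimes C^{\otimes k-1}$ of degree $2-k$ satisfying $\sum_{p+q+r=n,\,p,q\ge1}(-1)^{pq+r}(1_P\otimes1^{\otimes p-1}\otimes w_q\otimes1^{\otimes r})w^P_{p+1+r}+\sum_{b+c=n,\,b\ge1}(-1)^c(w^P_b\otimes1^{\otimes c})w^P_{c+1}=0$ for $n\ge1$. Morphisms in $\mathbf M^C$ are degree-preserving maps compatible with all structure maps. Graded dual: $C^*_n=Vect(C_{-n},K)$, an $A_\infty$-algebra with $m_k(\phi_1\otimes\dots\otimes\phi_k)=(-1)^{k(|\phi_1|+\dots+|\phi_k|+1)}\mu\circ(\phi_1\otimes\dots\otimes\phi_k)\circ w_k$, $\mu$ the multiplication of $K$. A pairing between $C$ and $A$ is a morphism of $A_\infty$-algebras $f=\{f_k:A^{\otimes k}\to C^*\}_{k\ge1}$. The induced functor meant is the composite of: the functor $\mathbf M^C\to{}_{C^*}\mathbf M$ regarding a right comodule $M$ as a left $C^*$-module via $(C^*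 )^{\otimes k-1}\otimes M\xrightarrow{1\otimes w^M_k}(C^* )^{\otimes k-1}\otimes M\otimes C^{\otimes k-1}\to M$ (the last map evaluating $(C^* )^{\otimes k-1}$ on $C^{\otimes k-1}$); and restriction of scalars ${}_{C^*}\mathbf M\to{}_A\mathbf M$ along $f$, given by $m^{A,M}_{k+1}=\sum(-1)^sm^{C^*,M}_{l+1}(f_{i_1}\otimes\dots\otimes f_{i_l}\otimes M)$, $k\ge0$, over decompositions $k=i_1+\dots+i_l$ with $s=(l-1)(i_1-1)+(l-2)(i_2-1)+\dots+(i_{l-1}-1)$.
   Formalization: The sign in restriction of scalars is s = l(i_1-1)+(l-1)(i_2-1)+...+(i_l-1) instead of (l-1)(i_1-1)+...+(i_{l-1}-1), since with the latter the operations fail the left A-infinity-module relations in general when char K is not 2. *)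

(* Defs.v *)
From HB Require Import structures.
From mathcomp Require Import all_boot all_order all_algebra.
From mathcomp Require Import finmap generic_quotient ring_quotient.
From mathcomp.multinomials Require Import monalg.
From mathcomp.classical Require Import boolp classical_sets functions fsbigop.

Set Implicit Arguments.
Unset Strict Implicit.
Unset Printing Implicit Defensive.

Import GRing.Theory.
Local Open Scope ring_scope.
Local Open Scope quotient_scope.

Inductive spanned (K : fieldType) (V : lmodType K) (R : V -> Prop) : V -> Prop :=
| spanned0 : spanned R 0
| spannedS a r v : R r -> spanned R v -> spanned R (a *: r + v).

Section Presentation.
Variables (K : fieldType) (X : choiceType) (R : {malg K[X]} -> Prop).

Definition relators : {pred {malg K[X]}} := fun g => `[< spanned R g >].

Lemma relators_closed : submod_closed relators.
Proof.
split=> [|a g h]; first by apply/asboolP; exact: spanned0.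
move=> /asboolP Rg /asboolP Rh; apply/asboolP.
elim: Rg => [|b r v Rr _ IH]; first by rewrite scaler0 add0r.
by rewrite scalerDr scalerA -addrA; apply: spannedS.
Qed.

HB.instance Definition _ :=
  GRing.isSubmodClosed.Build K {malg K[X]} relators relators_closed.

(** [presented R] is the quotient of the free module on [X] by the span of [R]. *)
Definition presented : Type := {ideal_quot relators}.

HB.instance Definition _ := GRing.Zmodule.on presented.

Definition pr (g : {malg K[X]}) : presented := \pi_({ideal_quot relators}) g.
Definition rp (t : presented) : {malg K[X]} := repr (t : {ideal_quot relators}).

Lemma prK t : pr (rp t) = t. Proof. exact: reprK. Qed.

Lemma pr_eq g h : pr g = pr h <-> g - h \in relators.
Proof.
rewrite Quotient.idealrBE; split=> [e|/eqP//].
by apply/eqP.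
Qed.

Lemma prB : {morph pr : g h / g - h}.
Proof. by move=> g h; rewrite /pr !piE. Qed.

Lemma prD : {morph pr : g h / g + h}.
Proof. by move=> g h; rewrite /pr !piE. Qed.

Definition pscale (a : K) (t : presented) : presented := pr (a *: rp t).

Lemma pr_scale a g : pr (a *: g) = pscale a (pr g).
Proof.
by apply/pr_eq; rewrite -scalerBr rpredZ //; apply/pr_eq; rewrite prK.
Qed.

Lemma pscaleA a b t : pscale a (pscale b t) = pscale (a * b) t.
Proof. by rewrite -[t]prK -!pr_scale scalerA. Qed.

Lemma pscale1 : left_id 1 pscale.
Proof. by move=> t; rewrite -[t]prK -pr_scale scale1r. Qed.

Lemma pscaleDr : right_distributive pscale +%R.
Proof.
by move=> a t u; rewrite -[t]prK -[u]prK -prD -!pr_scale -prD scalerDr.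
Qed.

Lemma pscaleDl t : {morph pscale^~ t : a b / a + b}.
Proof. by move=> a b; rewrite -[t]prK -!pr_scale -prD scalerDl. Qed.

HB.instance Definition _ := GRing.Zmodule_isLmodule.Build K presented
  pscaleA pscale1 pscaleDr pscaleDl.

Lemma pr_linear : linear pr.
Proof. by move=> a g h; rewrite prD pr_scale. Qed.

Definition gen (x : X) : presented := pr << x >>.

Section Lift.
Variables (W : lmodType K) (f : X -> W).

Definition lext (g : {malg K[X]}) : W := \sum_(x <- msupp g) g@_x *: f x.

Lemma lextE (A : {fset X}) g : (msupp g `<=` A)%fset ->
  lext g = \sum_(x <- A) g@_x *: f x.
Proof.
move=> sgA; rewrite /lext (big_fset_incl _ sgA) // => x _ xg.
by rewrite mcoeff_outdom // scale0r.
Qed.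

Lemma lext_linear : linear lext.
Proof.
move=> a g h; set A := (msupp (a *: g + h) `|` (msupp g `|` msupp h))%fset.
have [sgA shA] : (msupp g `<=` A)%fset /\ (msupp h `<=` A)%fset.
  by split; rewrite (fsubset_trans _ (fsubsetUr _ _)) ?fsubsetUl ?fsubsetUr.
rewrite !(@lextE A) ?fsubsetUl //.
rewrite scaler_sumr -big_split /=; apply: eq_bigr => x _.
by rewrite mcoeffD mcoeffZ scalerDl scalerA.
Qed.

HB.instance Definition _ := GRing.isLinear.Build K {malg K[X]} W *:%R lext lext_linear.

Lemma lextU x : lext << x >> = f x.
Proof.
rewrite (@lextE [fset x]%fset) ?msuppU_le // big_seq_fset1.
by rewrite mcoeffUU scale1r.
Qed.

(** The linear map [presented R -> W] with value [f x] on the generator [x]; it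
    depends on the choice of representatives unless [f] respects the relations. *)
Definition lift (t : presented) : W := lext (rp t).

Hypothesis fR : forall r, R r -> lext r = 0.

Lemma lext_relators g : g \in relators -> lext g = 0.
Proof.
move=> /asboolP; elim=> [|a r v /fR r0 _ v0]; first by rewrite linear0.
by rewrite lext_linear r0 v0 scaler0 addr0.
Qed.

Lemma lift_pr g : lift (pr g) = lext g.
Proof.
apply/eqP; rewrite -subr_eq0 -linearB; apply/eqP/lext_relators.
by apply/pr_eq; rewrite prK.
Qed.

Lemma lift_gen x : lift (gen x) = f x.
Proof. by rewrite lift_pr lextU. Qed.

Lemma lift_linear : linear lift.
Proof.
by move=> a t u; rewrite -[t]prK -[u]prK -pr_linear !lift_pr lext_linear.
Qed.
End Lift.

Lemma presented_ind (P : presented -> Prop) :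
  P 0 -> (forall a x t, P t -> P (a *: gen x + t)) -> forall t, P t.
Proof.
move=> P0 PS t; rewrite -[t]prK; move: (rp t) => g; rewrite [g]monalgE.
elim: (enum_fset (msupp g)) => [|x s IH].
  by rewrite big_nil -(subrr 0) prB subrr.
rewrite big_cons prD (_ : << _ *g x >> = g@_x *: << x >>) ?pr_scale; last first.
  by apply/malgP => y; rewrite mcoeffZ !mcoeffU mulrnAr mulr1.
exact: PS.
Qed.
End Presentation.

Section Tensors.
Variables (K : fieldType) (V : lmodType K).

Definition multilinear (W : lmodType K) (f : seq V -> W) :=
  forall u v, linear (fun x => f (u ++ x :: v)).

Definition tens_rel (g : {malg K[seq V]}) : Prop :=
  exists u v a x y,
    g = << u ++ (a *: x + y) :: v >> - (a *: << u ++ x :: v >> + << u ++ y :: v >>).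

(** The tensor algebra of [V], i.e. the direct sum of all tensor powers of [V];
    [tpure [:: x1; ...; xk]] is the pure tensor x1 ⊗ ... ⊗ xk. *)
Definition tens := presented tens_rel.
HB.instance Definition _ := GRing.Lmodule.on tens.

Definition tpure (s : seq V) : tens := gen tens_rel s.
Definition tlift (W : lmodType K) (f : seq V -> W) : tens -> W :=
  @lift K _ tens_rel W f.

Lemma tens_relP (W : lmodType K) (f : seq V -> W) : multilinear f ->
  forall r, tens_rel r -> lext f r = 0.
Proof.
move=> fL _ [u [v [a [x [y ->]]]]].
by rewrite linearB linearP /= !lextU (fL u v a x y) subrr.
Qed.

Lemma tlift_pure (W : lmodType K) (f : seq V -> W) s : multilinear f ->
  tlift f (tpure s) = f s.
Proof. by move=> /tens_relP fR; exact: lift_gen. Qed.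

Lemma tlift_linear (W : lmodType K) (f : seq V -> W) : multilinear f ->
  linear (tlift f).
Proof. by move=> /tens_relP fR; exact: lift_linear. Qed.

Lemma tpure_multilinear : multilinear tpure.
Proof.
move=> u v a x y; rewrite -[RHS](pr_linear tens_rel); apply/pr_eq/asboolP.
rewrite -[X in spanned _ X]addr0 -[X in X + 0]scale1r.
by apply: spannedS; [exists u, v, a, x, y | exact: spanned0].
Qed.

End Tensors.

Section PTensors.
Variables (K : fieldType) (P V : lmodType K).

Definition ptens_rel (g : {malg K[(P * seq V)%type]}) : Prop :=
  (exists s a x y, g = << (a *: x + y, s) >> - (a *: << (x, s) >> + << (y, s) >>)) \/
  (exists z u v a x y, g = << (z, u ++ (a *: x + y) :: v) >>
     - (a *: << (z, u ++ x :: v) >> + << (z, u ++ y :: v) >>)).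

(** The tensor product of [P] with the tensor algebra of [V]. *)
Definition ptens := presented ptens_rel.
HB.instance Definition _ := GRing.Lmodule.on ptens.

Definition ppure (z : P) (s : seq V) : ptens := gen ptens_rel (z, s).
Definition plift (W : lmodType K) (f : P -> seq V -> W) : ptens -> W :=
  @lift K _ ptens_rel W (fun zs => f zs.1 zs.2).

Definition pmultilinear (W : lmodType K) (f : P -> seq V -> W) :=
  (forall s, linear (f^~ s)) /\ (forall z, multilinear (f z)).

Lemma ptens_relP (W : lmodType K) (f : P -> seq V -> W) : pmultilinear f ->
  forall r, ptens_rel r -> lext (fun zs => f zs.1 zs.2) r = 0.
Proof.
move=> [fL1 fL2] _ [[s [a [x [y ->]]]]|[z [u [v [a [x [y ->]]]]]]].
  by rewrite linearB linearP /= !lextU /= (fL1 s a x y) subrr.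
by rewrite linearB linearP /= !lextU /= (fL2 z u v a x y) subrr.
Qed.

Lemma plift_pure (W : lmodType K) (f : P -> seq V -> W) z s : pmultilinear f ->
  plift f (ppure z s) = f z s.
Proof. by move=> /ptens_relP fR; exact: (lift_gen fR). Qed.

Lemma plift_linear (W : lmodType K) (f : P -> seq V -> W) : pmultilinear f ->
  linear (plift f).
Proof. by move=> /ptens_relP fR; exact: lift_linear. Qed.

Lemma ppure_pmultilinear : pmultilinear ppure.
Proof.
split=> [s a x y|z u v a x y]; rewrite -[RHS](pr_linear ptens_rel);
  apply/pr_eq/asboolP; rewrite -[X in spanned _ X]addr0 -[X in X + 0]scale1r;
  (apply: spannedS; last exact: spanned0).
- by left; exists s, a, x, y.
- by right; exists z, u, v, a, x, y.
Qed.

Lemma ptens_ind (Q : ptens -> Prop) :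
  Q 0 -> (forall a z s t, Q t -> Q (a *: ppure z s + t)) -> forall t, Q t.
Proof. by move=> Q0 QS; apply: presented_ind => // a [z s] t; apply: QS. Qed.
End PTensors.

(** [V] is the direct sum of its components [V_n], [n : int]; [gcomp n] is the
    projection onto [V_n]. *)
HB.mixin Record Lmodule_isGraded (K : fieldType) V of GRing.Lmodule K V := {
  gcomp : int -> V -> V;
  gcomp_linear : forall n, linear (gcomp n);
  gcompK : forall m n x, gcomp m (gcomp n x) = if m == n then gcomp n x else 0;
  gcomp_sum : forall x, exists2 s : seq int, uniq s & x = \sum_(n <- s) gcomp n x
}.

#[short(type="gradedType")]
HB.structure Definition Graded (K : fieldType) :=
  { V of GRing.Lmodule K V & Lmodule_isGraded K V }.

Section GradedTheory.
Variables (K : fieldType) (V : gradedType K).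
Implicit Types (x y : V) (n d : int).

Definition homog n x := gcomp n x == x.

Definition homogs (ds : seq int) (s : seq V) := all2 homog ds s.

HB.instance Definition _ n :=
  GRing.isLinear.Build K V V *:%R (@gcomp K V n) (gcomp_linear n).

Lemma gcomp_homog n x : homog n (gcomp n x).
Proof. by rewrite /homog gcompK eqxx. Qed.

Lemma gcomp_supp x : exists2 s : seq int, uniq s & forall n, n \notin s -> gcomp n x = 0.
Proof.
have [s us ->] := gcomp_sum x; exists s => // n ns.
rewrite linear_sum /= big_seq big1 // => m ms; rewrite gcompK.
by case: eqP ns => // ->; rewrite ms.
Qed.

Lemma gcomp_supp2 x y : exists2 s : seq int, uniq s &
  forall n, n \notin s -> gcomp n x = 0 /\ gcomp n y = 0.
Proof.
have [s us sx] := gcomp_supp x; have [t ut ty] := gcomp_supp y.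
exists (undup (s ++ t)); first exact: undup_uniq.
by move=> n; rewrite mem_undup mem_cat negb_or => /andP[/sx ? /ty].
Qed.

Section Gsum.
Variables (W : lmodType K) (F : int -> V -> W).

(** The map equal to [F n] on [V_n]. *)
Definition gsum x : W := \sum_(n \in [set: int]) F n (gcomp n x).

Hypothesis FL : forall n, linear (F n).

Lemma gsum0 n : F n 0 = 0.
Proof. by have := FL n (-1) 0 0; rewrite scaler0 addr0 scaleN1r addNr. Qed.

Lemma gsumE (s : seq int) x : uniq s -> (forall n, n \notin s -> gcomp n x = 0) ->
  gsum x = \sum_(n <- s) F n (gcomp n x).
Proof.
move=> us sx; rewrite /gsum (fsbigE s) //.
  by apply: eq_bigl => n; rewrite in_setT.
by move=> n _ /sx ->; exact: gsum0.
Qed.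

Lemma gsum_linear : linear gsum.
Proof.
move=> a x y; have [s us sxy] := gcomp_supp2 x y.
rewrite !(gsumE us); try by move=> n /sxy[].
  rewrite scaler_sumr -big_split; apply: eq_bigr => n _ /=.
  by rewrite gcomp_linear FL.
by move=> n /sxy[x0 y0]; rewrite gcomp_linear x0 y0 scaler0 addr0.
Qed.

Lemma gsum_homog n x : homog n x -> gsum x = F n x.
Proof.
move=> /eqP nx; rewrite (@gsumE [:: n]) // ?big_seq1 ?nx // => m.
by rewrite inE -nx gcompK => /negbTE ->.
Qed.
End Gsum.

(** (-1)^(d|x|) x, extended linearly: the sign of moving a map of degree [d] past [x]. *)
Definition koszul d : V -> V := gsum (fun n x => (-1) ^ (d * n) *: x).

Lemma koszul_linear d : linear (koszul d).
Proof.
by apply: gsum_linear => n a x y; rewrite scalerDr !scalerA mulrC.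
Qed.

Lemma koszulE d n x : homog n x -> koszul d x = (-1) ^ (d * n) *: x.
Proof.
by apply: gsum_homog => m a y z; rewrite scalerDr !scalerA mulrC.
Qed.

(** [t] lies in the degree [d] part of the [k]-th tensor power of [V]. *)
Definition tens_deg (k : nat) (d : int) : tens V -> Prop :=
  spanned (fun t => exists ds s, [/\ t = tpure s, size s = k, homogs ds s &
                                    d = \sum_(e <- ds) e]).
End GradedTheory.

(** [t] lies in the degree [d] part of P ⊗ V^{⊗k}. *)
Definition ptens_deg (K : fieldType) (P V : gradedType K) (k : nat) (d : int) :
    ptens P V -> Prop :=
  spanned (fun t => exists e ds z s, [/\ t = ppure z s, homog e z &
     [/\ size s = k, homogs ds s & d = e + \sum_(c <- ds) c]]).

Section GradedDual.
Variables (K : fieldType) (C : gradedType K).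

(** The direct sum of the spaces of functionals on [C_(-n)], n : int, as the space
    of all functionals on [C] that vanish on all but finitely many [C_n]. *)
Definition gdual_pred : {pred C -> K^o} := fun phi =>
  `[< linear phi /\
      exists s : seq int, forall n x, n \notin s -> phi (gcomp n x) = 0 >].

Lemma gdual_closed : submod_closed gdual_pred.
Proof.
split=> [|a f g]; first by apply/asboolP; split=> [b x y|]; [rewrite /= scaler0 addr0|exists [::]].
move=> /asboolP[fL [s fs]] /asboolP[gL [t gt]]; apply/asboolP; split=> [b x y|].
  rewrite !fctE fL gL !scalerDr !scalerA mulrC -!addrA; congr (_ + _).
  by rewrite addrCA.
exists (s ++ t) => n x; rewrite mem_cat negb_or => /andP[/fs-/(_ x) f0 /gt-/(_ x) g0].
by rewrite !fctE f0 g0 scaler0 addr0.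
Qed.

HB.instance Definition _ :=
  GRing.isSubmodClosed.Build K (C -> K^o) gdual_pred gdual_closed.

Record gdual := GDual { gdual_fun :> C -> K^o; _ : gdual_fun \in gdual_pred }.

HB.instance Definition _ := [isSub for gdual_fun].
HB.instance Definition _ := [Choice of gdual by <:].
HB.instance Definition _ := [SubChoice_isSubLmodule of gdual by <:].

Implicit Types (phi psi : gdual).

Lemma gdual_linear phi : linear phi.
Proof. by case: phi => f /= /asboolP[]. Qed.

Lemma gdual0 phi : phi 0 = 0.
Proof. by have := gdual_linear phi (-1) 0 0; rewrite scaler0 addr0 scaleN1r addNr. Qed.

Lemma gdual_ext phi psi : phi =1 psi -> phi = psi.
Proof. by move=> e; apply/val_inj/funext. Qed.

Lemma gdualZ a phi x : (a *: phi) x = a * phi x.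
Proof. by []. Qed.

Lemma gdual_sum (s : seq int) (F : int -> gdual) x :
  (\sum_(n <- s) F n) x = \sum_(n <- s) F n x.
Proof. by elim: s => [|n s IH]; rewrite ?big_nil // !big_cons -IH. Qed.

Lemma gdual_comp_subproof n phi : (fun x => phi (gcomp (- n) x)) \in gdual_pred.
Proof.
apply/asboolP; split=> [a x y|]; first by rewrite gcomp_linear gdual_linear.
exists [:: - n] => m x; rewrite inE gcompK eq_sym => /negbTE ->.
exact: gdual0.
Qed.

Definition gdual_comp n phi : gdual := GDual (gdual_comp_subproof n phi).

Lemma gdual_comp_linear n : linear (gdual_comp n).
Proof. by move=> a phi psi; apply: gdual_ext. Qed.

Lemma gdual_compK m n phi :
  gdual_comp m (gdual_comp n phi) = if m == n then gdual_comp n phi else 0.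
Proof.
apply: gdual_ext => x; rewrite /= gcompK eqr_opp eq_sym.
by case: eqP => [->|]// _; rewrite gdual0.
Qed.

Lemma gdual_comp_sum phi :
  exists2 s : seq int, uniq s & phi = \sum_(n <- s) gdual_comp n phi.
Proof.
have /asboolP[_ [s sphi]] := valP phi.
exists [seq - n | n <- undup s]; first by rewrite map_inj_uniq ?undup_uniq //; exact: oppr_inj.
apply: gdual_ext => x; rewrite gdual_sum big_map /=.
have [t ut xt] := gcomp_sum x.
have tx n : n \notin t -> gcomp n x = 0.
  move=> nt; rewrite xt linear_sum /= big_seq big1 // => m mt; rewrite gcompK.
  by case: eqP nt => // ->; rewrite mt.
have -> : phi x = \sum_(n <- t) phi (gcomp n x).
  by rewrite {1}xt; elim: (t) => [|m r IH];
     rewrite ?big_nil ?gdual0 // !big_cons -IH -[gcomp m x]scale1r gdual_linear !scale1r.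
transitivity (\sum_(n \in [set: int]) phi (gcomp n x)).
  rewrite (fsbigE t) //; last by move=> n _ /tx ->; rewrite gdual0.
  by apply: eq_bigl => n; rewrite in_setT.
rewrite (fsbigE (undup s)) ?undup_uniq //; last by move=> n _; rewrite mem_undup => /sphi.
by apply: eq_big => n; rewrite ?in_setT // opprK.
Qed.

HB.instance Definition _ := Lmodule_isGraded.Build K gdual
  gdual_comp_linear gdual_compK gdual_comp_sum.

(** (phi_1 ⊗ ... ⊗ phi_k)(x_1 ⊗ ... ⊗ x_k), followed by the multiplication of [K];
    the Koszul sign is created when phi_2 ⊗ ... ⊗ phi_k moves past x_1, etc. *)
Fixpoint evaluate (Phi : seq gdual) (s : seq C) {struct s} : K^o :=
  match Phi, s with
  | [::], [::] => 1
  | phi :: Phi', x :: s' =>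
      gsum (fun n y => phi y *: evaluate (map (koszul n) Phi') s') x
  | _, _ => 0
  end.
End GradedDual.

(** The operations m_k : A^{⊗k} -> A (and likewise the components f_k of a morphism)
    are packed into one multilinear function on words: [m [:: a1; ...; ak]] is
    m_k(a1 ⊗ ... ⊗ ak). There is no operation with k = 0; the value at the empty
    word is fixed to 0. In the equations, [map (koszul d) u] is the Koszul sign of
    moving a map of degree [d] past the word [u]. *)

(** [f] restricted to words of length [k] has degree [e k]. *)
Definition deg_words (K : fieldType) (V W : gradedType K) (e : nat -> int)
    (f : seq V -> W) : Prop :=
  forall ds s, homogs ds s -> homog (\sum_(d <- ds) d + e (size s)) (f s).

Section AinfAlgebra.
Variables (K : fieldType) (A : gradedType K) (m : seq A -> A).

Record is_ainf_alg : Prop := IsAinfAlg {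
  ainf_alg_nil : m [::] = 0;
  ainf_alg_multilinear : multilinear m;
  ainf_alg_deg : deg_words (fun k => 2 - k%:Z) m;
  ainf_alg_eq : forall s, let n := size s in (0 < n)%N ->
    \sum_(p < n.+1) \sum_(q < n.+1) \sum_(r < n.+1 | (p + q + r == n)%N && (0 < q)%N)
      (-1) ^+ (p + q * r) *:
      m (map (koszul (2 - q%:Z)) (take p s)
         ++ m (take q (drop p s)) :: drop (p + q) s) = 0
}.
End AinfAlgebra.

Record ainf_alg (K : fieldType) := AinfAlg {
  alg_space :> gradedType K;
  alg_op : seq alg_space -> alg_space;
  alg_axiom : is_ainf_alg alg_op
}.

Definition is_composition (n : nat) (i : seq nat) : bool :=
  (0%N \notin i) && (sumn i == n).

(** s = (t - 1)(i_1 - 1) + (t - 2)(i_2 - 1) + ... + (i_(t-1) - 1). *)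
Definition comp_sign (t : nat) (i : seq nat) : nat :=
  \sum_(j < t) (t.-1 - j) * (nth 0 i j).-1.

(** f_{i_1} ⊗ ... ⊗ f_{i_t}, for f_k of degree 1 - k, on a word of length i_1 + ... + i_t. *)
Fixpoint map_blocks (K : fieldType) (A : gradedType K) (B : Type) (f : seq A -> B)
    (i : seq nat) (s : seq A) : seq B :=
  match i with
  | [::] => [::]
  | i1 :: i' => f (map (koszul (\sum_(j <- i') (1 - j%:Z))) (take i1 s))
                :: map_blocks f i' (drop i1 s)
  end.

Section AinfMorphism.
Variables (K : fieldType) (A B : gradedType K).
Variables (mA : seq A -> A) (mB : seq B -> B) (f : seq A -> B).

Record is_ainf_morphism : Prop := IsAinfMorphism {
  ainf_morphism_nil : f [::] = 0;
  ainf_morphism_multilinear : multilinear f;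
  ainf_morphism_deg : deg_words (fun k => 1 - k%:Z) f;
  ainf_morphism_eq : forall s, let n := size s in (0 < n)%N ->
    \sum_(p < n.+1) \sum_(q < n.+1) \sum_(r < n.+1 | (p + q + r == n)%N && (0 < q)%N)
      (-1) ^+ (p + q * r) *:
      f (map (koszul (2 - q%:Z)) (take p s)
         ++ mA (take q (drop p s)) :: drop (p + q) s)
    = \sum_(t < n.+1 | (0 < t)%N)
      \sum_(i : t.-tuple 'I_n.+1 | is_composition n (map val i))
        (-1) ^+ comp_sign t (map val i) *: mB (map_blocks f (map val i) s)
}.
End AinfMorphism.

Section AinfModule.
Variables (K : fieldType) (A : ainf_alg K) (M : gradedType K).
(** [act [:: a1; ...; a_(k-1)] x] is m^M_k(a1 ⊗ ... ⊗ a_(k-1) ⊗ x). *)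
Variable act : seq A -> M -> M.

Record is_lmodule : Prop := IsLmodule {
  lmodule_multilinear : forall x, multilinear (act^~ x);
  lmodule_linear : forall s, linear (act s);
  lmodule_deg : forall ds s d x, homogs ds s -> homog d x ->
    homog (\sum_(e <- ds) e + d + (2 - (size s).+1%:Z)) (act s x);
  lmodule_eq : forall s x, let n := (size s).+1 in
    \sum_(p < n.+1) \sum_(q < n.+1)
      \sum_(r < n.+1 | [&& (p + q + r == n)%N, (0 < q)%N & (0 < r)%N])
      (-1) ^+ (p + q * r) *:
      act (map (koszul (2 - q%:Z)) (take p s)
           ++ alg_op (take q (drop p s)) :: drop (p + q) s) x
    + \sum_(a < n.+1) \sum_(b < n.+1 | (a + b == n)%N && (0 < b)%N)
      (-1) ^+ a *:
      act (map (koszul (2 - b%:Z)) (take a s)) (act (drop a s) x) = 0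
}.
End AinfModule.

Record lmodule (K : fieldType) (A : ainf_alg K) := Lmodule {
  lmodule_space :> gradedType K;
  lmodule_act : seq A -> lmodule_space -> lmodule_space;
  lmodule_axiom : is_lmodule lmodule_act
}.

Record is_lmodule_hom (K : fieldType) (A : ainf_alg K) (M N : gradedType K)
    (actM : seq A -> M -> M) (actN : seq A -> N -> N) (g : M -> N) : Prop :=
  IsLmoduleHom {
    lmodule_hom_linear : linear g;
    lmodule_hom_deg : forall d x, homog d x -> homog d (g x);
    lmodule_hom_act : forall s x, g (actM s x) = actN s (g x)
  }.

Record lmodule_hom (K : fieldType) (A : ainf_alg K) (M N : lmodule A) :=
  LmoduleHom {
    lmodule_map :> M -> N;
    lmodule_map_axiom :
      is_lmodule_hom (@lmodule_act _ _ M) (@lmodule_act _ _ N) lmodule_map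
  }.

Section AinfCoalgebra.
Variables (K : fieldType) (C : gradedType K) (w : nat -> C -> tens C).

(** 1^{⊗p} ⊗ w_q ⊗ 1^{⊗r}, where r + p + 1 is the length of the word. *)
Definition id_w_id (p q : nat) : tens C -> tens C :=
  tlift (fun s => tlift (fun s' =>
    tpure (map (koszul (2 - q%:Z)) (take p s) ++ s' ++ drop p.+1 s))
    (w q (nth 0 s p))).

Record is_ainf_coalg : Prop := IsAinfCoalg {
  ainf_coalg_zero : forall x, w 0 x = 0;
  ainf_coalg_linear : forall k, linear (w k);
  ainf_coalg_deg : forall k d x, (0 < k)%N -> homog d x ->
    tens_deg k (d + (2 - k%:Z)) (w k x);
  ainf_coalg_eq : forall n x, (0 < n)%N ->
    \sum_(p < n.+1) \sum_(q < n.+1) \sum_(r < n.+1 | (p + q + r == n)%N && (0 < q)%N)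
      (-1) ^+ (p * q + r) *: id_w_id p q (w (p + 1 + r)%N x) = 0;
  (* the product of the w_k lands in the direct sum of the C^{⊗k} *)
  ainf_coalg_finite : forall x, exists N, forall k, (N < k)%N -> w k x = 0
}.
End AinfCoalgebra.

Record ainf_coalg (K : fieldType) := AinfCoalg {
  coalg_space :> gradedType K;
  coalg_op : nat -> coalg_space -> tens coalg_space;
  coalg_axiom : is_ainf_coalg coalg_op
}.

Section AinfComodule.
Variables (K : fieldType) (C : ainf_coalg K) (P : gradedType K).
(** [wP k] is w^P_k : P -> P ⊗ C^{⊗k-1}, for k >= 1; [wP 0] is fixed to 0. *)
Variable wP : nat -> P -> ptens P C.

(** 1_P ⊗ 1^{⊗p-1} ⊗ w_q ⊗ 1^{⊗r}. *)
Definition idP_w_id (p q : nat) : ptens P C -> ptens P C :=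
  plift (fun z s => tlift (fun s' =>
    ppure (koszul (2 - q%:Z) z)
      (map (koszul (2 - q%:Z)) (take p.-1 s) ++ s' ++ drop p s))
    (coalg_op q (nth 0 s p.-1))).

(** w^P_b ⊗ 1^{⊗c}. *)
Definition wP_id (b : nat) : ptens P C -> ptens P C :=
  plift (fun z s => plift (fun y s' => ppure y (s' ++ s)) (wP b z)).

Record is_rcomodule : Prop := IsRcomodule {
  rcomodule_zero : forall x, wP 0 x = 0;
  rcomodule_linear : forall k, linear (wP k);
  rcomodule_deg : forall k d x, (0 < k)%N -> homog d x ->
    ptens_deg k.-1 (d + (2 - k%:Z)) (wP k x);
  rcomodule_eq : forall n x, (0 < n)%N ->
    \sum_(p < n.+1) \sum_(q < n.+1)
      \sum_(r < n.+1 | [&& (p + q + r == n)%N, (0 < p)%N & (0 < q)%N])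
      (-1) ^+ (p * q + r) *: idP_w_id p q (wP (p + 1 + r)%N x)
    + \sum_(b < n.+1) \sum_(c < n.+1 | (b + c == n)%N && (0 < b)%N)
      (-1) ^+ c *: wP_id b (wP c.+1 x) = 0
}.
End AinfComodule.

Record rcomodule (K : fieldType) (C : ainf_coalg K) := Rcomodule {
  rcomodule_space :> gradedType K;
  rcomodule_coact : nat -> rcomodule_space -> ptens rcomodule_space C;
  rcomodule_axiom : is_rcomodule rcomodule_coact
}.

(** g ⊗ 1. *)
Definition ptens_map (K : fieldType) (P Q V : lmodType K) (g : P -> Q) :
    ptens P V -> ptens Q V :=
  plift (fun z s => ppure (g z) s).

Record is_rcomodule_hom (K : fieldType) (C : ainf_coalg K) (P Q : gradedType K)
    (wP : nat -> P -> ptens P C) (wQ : nat -> Q -> ptens Q C) (g : P -> Q) : Prop :=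
  IsRcomoduleHom {
    rcomodule_hom_linear : linear g;
    rcomodule_hom_deg : forall d x, homog d x -> homog d (g x);
    rcomodule_hom_coact : forall k x, ptens_map g (wP k x) = wQ k (g x)
  }.

Record rcomodule_hom (K : fieldType) (C : ainf_coalg K) (P Q : rcomodule C) :=
  RcomoduleHom {
    rcomodule_map :> P -> Q;
    rcomodule_map_axiom :
      is_rcomodule_hom (@rcomodule_coact _ _ P) (@rcomodule_coact _ _ Q) rcomodule_map
  }.

Section DualAlgebra.
Variables (K : fieldType) (C : ainf_coalg K).

Lemma evaluate_multilinear (Phi : seq (gdual C)) : multilinear (evaluate Phi).
Proof.
move=> u; elim: u Phi => [|c u IH] [|phi Phi] v a x y /=.
- by rewrite scaler0 addr0.
- apply: gsum_linear => n b z t.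
  by rewrite gdual_linear scalerDl scalerA.
- by rewrite scaler0 addr0.
have [s us sc] := gcomp_supp c.
rewrite !(gsumE _ us) //; try by move=> n b z t; rewrite gdual_linear scalerDl scalerA.
rewrite scaler_sumr -big_split; apply: eq_bigr => n _ /=.
by rewrite IH scalerDr !scalerA [_ * a]mulrC.
Qed.

Definition gdual_supp (T : seq int) (phi : gdual C) :=
  forall n x, n \notin T -> phi (gcomp n x) = 0.

Lemma gdual_supp_ex phi : exists T, gdual_supp T phi.
Proof. by have /asboolP[_ [T]] := valP phi; exists T. Qed.

Lemma gdual_supp_koszul d T phi : gdual_supp T phi -> gdual_supp T (koszul d phi).
Proof.
move=> Tphi n x nT; have [s us sphi] := gcomp_supp phi.
rewrite /koszul (gsumE _ us) //; last first.
  by move=> m a y z; rewrite scalerDr !scalerA mulrC.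
rewrite gdual_sum big1 // => m _; rewrite gdualZ /= gcompK.
by case: eqP => _; rewrite ?Tphi ?gdual0 ?mulr0.
Qed.

Lemma evaluate_supp (Phi : seq (gdual C)) : exists S : seq int,
  forall ds s, homogs ds s -> \sum_(d <- ds) d \notin S -> evaluate Phi s = 0.
Proof.
have [Ts PhiTs] : exists Ts, size Ts = size Phi /\
    forall i, (i < size Phi)%N -> gdual_supp (nth [::] Ts i) (nth 0 Phi i).
  elim: Phi => [|phi Phi [Ts [eT PT]]]; first by exists [::].
  have [T phiT] := gdual_supp_ex phi.
  by exists (T :: Ts); split=> [|[|i]] /=; [rewrite eT | | apply: PT].
pose sums := foldr (fun T S : seq int => [seq a + b | a <- T, b <- S]) [:: 0].
exists (sums Ts) => ds s; elim: Ts Phi PhiTs ds s => [|T Ts IH] [|phi Phi] [] //=.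
  by move=> _ _ [|d ds] [|x s] //= _; rewrite big_nil inE eqxx.
move=> [eT] PT [|d ds] [|x s] //= /andP[dx hs]; rewrite big_cons => nS.
rewrite (gsum_homog _ dx); last first.
  by move=> n b z t; rewrite gdual_linear scalerDl scalerA.
have [dT|dT] := boolP (d \in T); last first.
  by rewrite -(eqP dx) (PT 0%N) // scale0r.
rewrite (IH _ _ ds) ?scaler0 //.
  split=> [|i]; rewrite size_map // => ilt.
  by rewrite (nth_map 0) //; apply/gdual_supp_koszul/(PT i.+1).
by apply: contra nS => dsS; apply: allpairs_f.
Qed.

(** m_k(phi_1 ⊗ ... ⊗ phi_k)
      = (-1)^(k(|phi_1| + ... + |phi_k| + 1)) mu o (phi_1 ⊗ ... ⊗ phi_k) o w_k. *)
Definition dual_op_fun (Phi : seq (gdual C)) : C -> K^o := fun x =>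
  let k := size Phi in
  (-1) ^+ k *: tlift (evaluate (map (koszul k%:Z) Phi)) (coalg_op k x).

Lemma dual_op_subproof Phi : dual_op_fun Phi \in @gdual_pred K C.
Proof.
have [w0 wL wdeg _ _] := coalg_axiom C.
set k := size Phi; set Psi := map (koszul k%:Z) Phi.
have eL := evaluate_multilinear Psi.
apply/asboolP; split=> [a x y|].
  by rewrite /dual_op_fun wL (tlift_linear eL) scalerDr !scalerA mulrC.
have [S SP] := evaluate_supp Psi.
exists [seq d - (2 - k%:Z) | d <- S] => n x nS; rewrite /dual_op_fun -/k -/Psi.
have t0 : tlift (evaluate Psi) 0 = 0.
  by have := tlift_linear eL (-1) 0 0; rewrite scaler0 addr0 scaleN1r addNr.
have [k0|k0] := posnP k; first by rewrite k0 w0 t0 scaler0.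
have := wdeg _ _ _ k0 (gcomp_homog n x).
elim=> [|a r v [ds [s [-> _ hs e]]] _ IH]; first by rewrite t0 scaler0.
rewrite (tlift_linear eL) scalerDr IH addr0 (tlift_pure _ eL) (SP ds) ?scaler0 //.
by apply: contra nS => dS; apply/mapP; exists (\sum_(d <- ds) d); rewrite // -e addrK.
Qed.

Definition dual_op (Phi : seq (gdual C)) : gdual C := GDual (dual_op_subproof Phi).

(** The left action of C^* on a right comodule: [act] on phi_1, ..., phi_(k-1), x is
    the evaluation of (1 ⊗ w^M_k)(phi_1 ⊗ ... ⊗ phi_(k-1) ⊗ x). The first [koszul]
    moves w^M_k, the second one moves phi_1 ⊗ ... ⊗ phi_(k-1) past M. *)
Definition dual_act (M : gradedType K) (wM : nat -> M -> ptens M C)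
    (Phi : seq (gdual C)) (x : M) : M :=
  let k := (size Phi).+1 in
  let Psi := map (koszul (2 - k%:Z)) Phi in
  plift (fun (z : M) s => gsum (fun n y => (evaluate (map (koszul n) Psi) s : K) *: y) z)
    (wM k x).
End DualAlgebra.

Record pairing (K : fieldType) (C : ainf_coalg K) (A : ainf_alg K) := Pairing {
  pairing_map :> seq A -> gdual C;
  pairing_axiom : is_ainf_morphism (@alg_op K A) (@dual_op K C) pairing_map
}.

(** Restriction of scalars along [f]. The sign is the one of [is_ainf_morphism] for
    the tensor product f_{i_1} ⊗ ... ⊗ f_{i_l} ⊗ 1_M of [l.+1] maps, that is
    s = l(i_1 - 1) + (l - 1)(i_2 - 1) + ... + (i_l - 1). Leaving out the factor 1_M,
    i.e. taking s = (l - 1)(i_1 - 1) + ... + (i_(l-1) - 1), does not give a left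
    module in characteristic other than 2 (it is the sign for right modules). *)
Definition restrict (K : fieldType) (A : gradedType K) (B : Type) (M : lmodType K)
    (f : seq A -> B) (act : seq B -> M -> M) (s : seq A) (x : M) : M :=
  let k := size s in
  \sum_(l < k.+1) \sum_(i : l.-tuple 'I_k.+1 | is_composition k (map val i))
    (-1) ^+ comp_sign l.+1 (map val i) *: act (map_blocks f (map val i) s) x.

Record category := Category {
  obj :> Type;
  hom : obj -> obj -> Type;
  idm : forall X, hom X X;
  compm : forall X Y Z, hom Y Z -> hom X Y -> hom X Z;
  compm1 : forall X Y (g : hom X Y), compm g (idm X) = g;
  comp1m : forall X Y (g : hom X Y), compm (idm Y) g = g;
  compmA : forall X Y Z T (h : hom Z T) (g : hom Y Z) (e : hom X Y),
    compm h (compm g e) = compm (compm h g) e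
}.

Record is_functor (C D : category) (F : C -> D)
    (Fm : forall X Y, hom X Y -> hom (F X) (F Y)) : Prop := IsFunctor {
  functor_id : forall X, Fm X X (idm X) = idm (F X);
  functor_comp : forall X Y Z (h : hom Y Z) (g : hom X Y),
    Fm X Z (compm h g) = compm (Fm Y Z h) (Fm X Y g)
}.

Section ModuleCategory.
Variables (K : fieldType) (A : ainf_alg K).

Lemma lmodule_hom_ext (M N : lmodule A) (g h : lmodule_hom M N) : g =1 h -> g = h.
Proof.
case: g h => [g Hg] [h Hh] /= /funext e; case: _ / e in Hh *.
by congr LmoduleHom; exact: Prop_irrelevance.
Qed.

Lemma lmodule_id_axiom (M : lmodule A) :
  is_lmodule_hom (@lmodule_act _ _ M) (@lmodule_act _ _ M) id.
Proof. by []. Qed.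

Lemma lmodule_comp_axiom (M N L : lmodule A) (h : lmodule_hom N L)
    (g : lmodule_hom M N) :
  is_lmodule_hom (@lmodule_act _ _ M) (@lmodule_act _ _ L) (h \o g).
Proof.
case: h g => [h [hL hd ha]] [g [gL gd ga]]; split=> /=.
- by move=> a x y /=; rewrite gL hL.
- by move=> d x /gd /hd.
- by move=> s x; rewrite ga ha.
Qed.

Definition lmodule_category : category.
Proof.
refine (@Category (lmodule A) (@lmodule_hom K A)
  (fun M => LmoduleHom (lmodule_id_axiom M))
  (fun M N L h g => LmoduleHom (lmodule_comp_axiom h g)) _ _ _);
  by move=> *; apply: lmodule_hom_ext.
Defined.
End ModuleCategory.

Section ComoduleCategory.
Variables (K : fieldType) (C : ainf_coalg K).

Lemma rcomodule_hom_ext (P Q : rcomodule C) (g h : rcomodule_hom P Q) : g =1 h -> g = h.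
Proof.
case: g h => [g Hg] [h Hh] /= /funext e; case: _ / e in Hh *.
by congr RcomoduleHom; exact: Prop_irrelevance.
Qed.

Lemma ptens_map_pmultilinear (P Q V : lmodType K) (g : P -> Q) : linear g ->
  pmultilinear (fun z (s : seq V) => ppure (g z) s).
Proof.
have [L1 L2] := ppure_pmultilinear Q V.
by move=> gL; split=> [s a x y|z]; [rewrite gL L1 | exact: L2].
Qed.

Lemma rcomodule_id_axiom (P : rcomodule C) :
  is_rcomodule_hom (@rcomodule_coact _ _ P) (@rcomodule_coact _ _ P) id.
Proof.
split=> // k x; have gL : linear (id : P -> P) by [].
have H := ptens_map_pmultilinear C gL; rewrite /ptens_map.
elim/ptens_ind: (rcomodule_coact k x) => [|a z s t IH].
  by have := plift_linear H (-1) 0 0; rewrite scaler0 addr0 scaleN1r addNr.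
by rewrite (plift_linear H) (plift_pure _ _ H) IH.
Qed.

Lemma rcomodule_comp_axiom (P Q R : rcomodule C) (h : rcomodule_hom Q R)
    (g : rcomodule_hom P Q) :
  is_rcomodule_hom (@rcomodule_coact _ _ P) (@rcomodule_coact _ _ R) (h \o g).
Proof.
case: h g => [h [hL hd hw]] [g [gL gd gw]]; split=> /=.
- by move=> a x y /=; rewrite gL hL.
- by move=> d x /gd /hd.
move=> k x; have hgL : linear (h \o g) by move=> a y z /=; rewrite gL hL.
rewrite -hw -gw /ptens_map.
have Hg := ptens_map_pmultilinear C gL.
have Hh := ptens_map_pmultilinear C hL.
have Hhg := ptens_map_pmultilinear C hgL.
elim/ptens_ind: (rcomodule_coact k x) => [|a z s t IH].
  have z0 (U W : lmodType K) (F : U -> W) : linear F -> F 0 = 0.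
    by move=> FL; have := FL (-1) 0 0; rewrite scaler0 addr0 scaleN1r addNr.
  by rewrite !(z0 _ _ _ (plift_linear _)).
by rewrite (plift_linear Hg) (plift_linear Hh) (plift_linear Hhg) IH !plift_pure.
Qed.

Definition rcomodule_category : category.
Proof.
refine (@Category (rcomodule C) (@rcomodule_hom K C)
  (fun P => RcomoduleHom (rcomodule_id_axiom P))
  (fun P Q R h g => RcomoduleHom (rcomodule_comp_axiom h g)) _ _ _);
  by move=> *; apply: rcomodule_hom_ext.
Defined.
End ComoduleCategory.

Definition pairing_act (K : fieldType) (C : ainf_coalg K) (A : ainf_alg K)
    (f : pairing C A) (M : rcomodule C) : seq A -> M -> M :=
  restrict f (dual_act (@rcomodule_coact _ _ M)).
Arguments pairing_act {K C A} f M.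

(* Main.v *)
(** Signs are removed first. Let tau x = (-1)^|x| x, and precompose every operation with
    the word transformation (a_1, ..., a_k) |-> (tau^(k-1) a_1, ..., tau a_(k-1), a_k).
    The operations and the structure maps then have degree 1, the components of a
    morphism have degree 0, and all numerical signs disappear; moving an operation past x
    costs the map x |-> - tau x. Restriction along f becomes the unsigned sum of
    act (f b_1, ..., f b_l) over all decompositions of a word into blocks. In the module
    equation of the restriction, the terms in which the operation of A lands in a given
    block add up, by the morphism equation, to the terms in which an operation of C^* is
    applied to a group of consecutive blocks; this leaves the module equation over C^*
    for each decomposition.

    The module equation over C^* is multilinear, so it only has to be checked on
    homogeneous functionals phi_1, ..., phi_k. On these the Koszul sign of the evaluation
    depends on the degrees of the phi_i alone, and the equation is, up to a global sign,
    the comodule equation of M contracted with phi_1 ⊗ ... ⊗ phi_k. *)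
Require Import Defs.
From mathcomp Require Import all_boot all_algebra.
From mathcomp Require Import zify.

Set Implicit Arguments.
Unset Strict Implicit.
Unset Printing Implicit Defensive.

Import GRing.Theory.
Local Open Scope ring_scope.

(** * Linear and multilinear maps *)

Section Linear.
Variables (K : fieldType) (V W : lmodType K).
Implicit Types g : V -> W.

Lemma lin0 g : linear g -> g 0 = 0.
Proof. by move=> gL; have := gL (-1) 0 0; rewrite scaler0 addr0 scaleN1r addNr. Qed.

Lemma linZ g a x : linear g -> g (a *: x) = a *: g x.
Proof. by move=> gL; have := gL a x 0; rewrite !addr0 lin0 // addr0. Qed.

Lemma linD g x y : linear g -> g (x + y) = g x + g y.
Proof. by move=> gL; have := gL 1 x y; rewrite !scale1r. Qed.

Lemma linN g x : linear g -> g (- x) = - g x.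
Proof. by move=> gL; rewrite -scaleN1r linZ // scaleN1r. Qed.

Lemma lin_sum g (I : Type) (r : seq I) (P : pred I) (F : I -> V) : linear g ->
  g (\sum_(i <- r | P i) F i) = \sum_(i <- r | P i) g (F i).
Proof. by move=> gL; apply: big_morph => [x y|]; rewrite (linD, lin0). Qed.

Lemma sum_linear (I : Type) (r : seq I) (P : pred I) (F : I -> V -> W) :
  (forall i, linear (F i)) -> linear (fun x => \sum_(i <- r | P i) F i x).
Proof.
move=> FL a x y; rewrite scaler_sumr -big_split; apply: eq_bigr => i _.
exact: FL.
Qed.

Lemma scale_linear (c : K) g : linear g -> linear (fun x => c *: g x).
Proof. by move=> gL a x y; rewrite gL scalerDr !scalerA mulrC. Qed.
End Linear.

Section Multilinear.
Variables (K : fieldType) (V W : lmodType K).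
Implicit Types (f : seq V -> W).

Lemma multilinear_head f x : multilinear f -> multilinear (fun s => f (x :: s)).
Proof. by move=> fL u v; apply: (fL (x :: u)). Qed.

Lemma multilinear_suffix f t : multilinear f -> multilinear (fun s => f (s ++ t)).
Proof. by move=> fL u v a x y; rewrite -!catA; apply: fL. Qed.

Lemma multilinear_prefix f t : multilinear f -> multilinear (fun s => f (t ++ s)).
Proof. by move=> fL u v a x y; rewrite !catA; apply: fL. Qed.

Lemma multilinear_map (U : lmodType K) (h : U -> V) f : linear h -> multilinear f ->
  multilinear (fun s => f (map h s)).
Proof. by move=> hL fL u v a x y; rewrite !map_cat /= hL; apply: fL. Qed.

Lemma multilinear_comp (U : lmodType K) (h : W -> U) f : linear h -> multilinear f ->
  multilinear (fun s => h (f s)).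
Proof. by move=> hL fL u v a x y; rewrite fL hL. Qed.

Lemma multilinear_scale (c : K) f : multilinear f -> multilinear (fun s => c *: f s).
Proof. by move=> fL u v; apply: scale_linear; exact: fL. Qed.

Lemma multilinear_add f g : multilinear f -> multilinear g ->
  multilinear (fun s => f s + g s).
Proof.
by move=> fL gL u v a x y; rewrite fL gL scalerDr -!addrA; congr (_ + _); rewrite addrCA.
Qed.

Lemma multilinear_sum (I : Type) (r : seq I) (P : pred I) (F : I -> seq V -> W) :
  (forall i, P i -> multilinear (F i)) -> multilinear (fun s => \sum_(i <- r | P i) F i s).
Proof.
move=> FL u v a x y; rewrite scaler_sumr -big_split; apply: eq_bigr => i Pi.
exact: (FL i Pi u v a x y).
Qed.

(** Varying one letter does not change the length of the word, so the scalar may depend on that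
    length. *)
Lemma multilinear_size (c : nat -> K) f : multilinear f ->
  multilinear (fun s => c (size s) *: f s).
Proof.
by move=> fL u v a x y; rewrite !size_cat /= fL scalerDr !scalerA [c _ * a]mulrC.
Qed.

(** The varied letter keeps its position, so it always falls on the same side of the cut. *)
Lemma multilinear_take_drop p (g : seq V -> seq V -> W) :
  (forall v, multilinear (g^~ v)) -> (forall u, multilinear (g u)) ->
  multilinear (fun s => g (take p s) (drop p s)).
Proof.
move=> gL1 gL2 u v a x y; rewrite !take_cat !drop_cat.
have [ltpu|leup] := ltnP p (size u); first exact: gL2.
by case: (p - size u)%N => [|k] /=; [rewrite !cats0; exact: (gL2 u [::]) | exact: gL1].
Qed.

Lemma multilinear_opp f s : multilinear f ->
  f (map -%R s) = (-1) ^+ size s *: f s.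
Proof.
move=> fL; rewrite -[map _ s]cat0s -[X in _ *: f X]cat0s.
elim: s [::] => [|a s IH] u /=; first by rewrite expr0 scale1r.
rewrite (linN _ (fL u _)) -cat_rcons IH cat_rcons.
by rewrite exprS -scalerA scaleN1r.
Qed.
End Multilinear.

(** * Parity and Koszul signs *)
Definition par (d : int) : bool := odd `|d|%N.

Lemma parN d : par (- d) = par d. Proof. by rewrite /par abszN. Qed.

Lemma par_nat (n : nat) : par n%:Z = odd n. Proof. by []. Qed.

Lemma parD d e : par (d + e) = par d (+) par e.
Proof. rewrite /par; lia. Qed.

Lemma parM d e : par (d * e) = par d && par e.
Proof. by rewrite /par abszM oddM. Qed.

Lemma par_sign (R : unitRingType) d : (-1) ^ d = (-1) ^+ par d :> R.
Proof.
rewrite /par signr_odd; case: d => n //.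
by rewrite NegzE abszN /= -exprz_inv invrN1.
Qed.

Section Koszul.
Variables (K : fieldType) (V : gradedType K).
Implicit Types (x y : V) (s : seq V) (b c : bool).

(** The Koszul sign depends only on the parity of the degree. With a boolean index these maps
    compose by exclusive or, and sign identities become finite case checks. *)
Definition kos b x : V := koszul b%:Z x.

Lemma gcomp_ind (P : V -> Prop) : P 0 -> (forall x y, P x -> P y -> P (x + y)) ->
  (forall n x, homog n x -> P x) -> forall x, P x.
Proof.
move=> P0 PD Ph x; have [s _ ->] := gcomp_sum x.
by apply: (big_ind P) => // n _; apply: (Ph n); exact: gcomp_homog.
Qed.

Lemma kos_linear b : linear (kos b). Proof. exact: koszul_linear. Qed.

Lemma kosE b n x : homog n x -> kos b x = (-1) ^+ (b && par n) *: x.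
Proof. by move=> hx; rewrite /kos (koszulE _ hx) par_sign parM; case: b. Qed.

Lemma koszul_kos d : koszul d =1 kos (par d) :> (V -> V).
Proof.
apply: gcomp_ind => [|x y ex ey|n x hx].
- by rewrite /kos !lin0 //; exact: koszul_linear.
- by rewrite /kos !linD ?ex ?ey //; exact: koszul_linear.
- by rewrite (kosE _ hx) (koszulE _ hx) par_sign parM.
Qed.

Lemma kos_comp b c x : kos b (kos c x) = kos (b (+) c) x.
Proof.
elim/gcomp_ind: x => [|x y ex ey|n x hx].
- by rewrite !(lin0 (kos_linear _)).
- by rewrite !(linD _ _ (kos_linear _)) ex ey.
rewrite !(kosE _ hx) (linZ _ _ (kos_linear _)) (kosE _ hx) scalerA -signr_addb.
by case: b c (par n) => [] [] [].
Qed.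

Lemma kos0 x : kos false x = x.
Proof.
elim/gcomp_ind: x => [|x y ex ey|n x hx].
- by rewrite (lin0 (kos_linear _)).
- by rewrite (linD _ _ (kos_linear _)) ex ey.
by rewrite (kosE _ hx) expr0 scale1r.
Qed.

Lemma homogZ n a x : homog n x -> homog n (a *: x).
Proof. by rewrite /homog => /eqP e; rewrite (linZ _ _ (gcomp_linear n)) e. Qed.

Lemma homog0 n : homog n (0 : V).
Proof. by rewrite /homog (lin0 (gcomp_linear n)). Qed.

Lemma homog_sum n (I : Type) (r : seq I) (P : pred I) (F : I -> V) :
  (forall i, P i -> homog n (F i)) -> homog n (\sum_(i <- r | P i) F i).
Proof.
move=> FP; rewrite /homog (lin_sum _ _ _ (gcomp_linear n)).
by apply/eqP/eq_bigr => i /FP/eqP.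
Qed.

Lemma homog_koszul d n x : homog n x -> homog n (koszul d x).
Proof. by move=> hx; rewrite (koszulE _ hx) homogZ. Qed.

Lemma homogs_size ds s : homogs ds s -> size ds = size s.
Proof. by rewrite /homogs all2E => /andP[/eqP]. Qed.

Lemma homogs_koszul d ds s : homogs ds s -> homogs ds (map (koszul d) s).
Proof.
elim: ds s => [|n ds IH] [|x s] //= /andP[hx hs].
by rewrite homog_koszul //= IH.
Qed.

Lemma homogs_take n ds s : homogs ds s -> homogs (take n ds) (take n s).
Proof.
elim: ds s n => [|m ds IH] [|x s] [|n] //= /andP[hx hs].
by rewrite hx /= IH.
Qed.

Lemma homogs_drop n ds s : homogs ds s -> homogs (drop n ds) (drop n s).
Proof. by elim: ds s n => [|m ds IH] [|x s] [|n] //= /andP[hx hs]; apply: IH. Qed.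

Lemma homogs_cat ds es s t : homogs ds s -> homogs es t -> homogs (ds ++ es) (s ++ t).
Proof. by elim: ds s => [|n ds IH] [|x s] //= /andP[-> hs] ht; apply: IH. Qed.

Lemma multilinear_homog_eq (W : lmodType K) (f g : seq V -> W) :
  multilinear f -> multilinear g ->
  (forall ds s, homogs ds s -> f s = g s) -> f =1 g.
Proof.
move=> fL gL fg v.
(* Letters are made homogeneous from left to right; [u] is the part already treated. *)
suff H u ds : homogs ds u -> f (u ++ v) = g (u ++ v) by exact: (H [::] [::]).
elim: v u ds => [|x v IH] u ds hu; first by rewrite cats0; exact: fg hu.
elim/gcomp_ind: x => [|x y ex ey|n x hx].
- by rewrite (lin0 (fL u v)) (lin0 (gL u v)).
- by rewrite (linD _ _ (fL u v)) (linD _ _ (gL u v)) ex ey.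
rewrite -cat_rcons; apply: (IH _ (ds ++ [:: n])).
by rewrite -cats1; apply: homogs_cat => //=; rewrite hx.
Qed.

(** Precomposition with [bar] removes the combinatorial signs, such as (-1)^(p+qr) and
    [comp_sign], from all equations. *)
Fixpoint bar s : seq V :=
  if s is x :: s' then kos (odd (size s')) x :: bar s' else [::].

Lemma size_bar s : size (bar s) = size s.
Proof. by elim: s => //= x s ->. Qed.

Lemma map_kos_comp b c s : map (kos b) (map (kos c) s) = map (kos (b (+) c)) s.
Proof. by rewrite -map_comp; apply: eq_map => x; exact: kos_comp. Qed.

Lemma map_kos0 s : map (kos false) s = s.
Proof. by rewrite (eq_map (g := id)) ?map_id // => x; rewrite kos0. Qed.

Lemma bar_kos b s : bar (map (kos b) s) = map (kos b) (bar s).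
Proof. by elim: s => //= x s ->; rewrite size_map !kos_comp addbC. Qed.

Lemma bar_cat s t : bar (s ++ t) = map (kos (odd (size t))) (bar s) ++ bar t.
Proof. by elim: s => //= x s ->; rewrite kos_comp size_cat oddD addbC. Qed.

Lemma barK s : bar (bar s) = s.
Proof. by elim: s => //= x s ->; rewrite size_bar kos_comp addbb kos0. Qed.

Lemma bar_opp s : bar (map -%R s) = map -%R (bar s).
Proof.
elim: s => //= x s ->; rewrite size_map; congr (_ :: _).
exact: linN (kos_linear _).
Qed.

(** The sign of moving an operation past [x] once both have been shifted. *)
Definition dl x : V := - kos true x.

Lemma multilinear_bar (W : lmodType K) (f : seq V -> W) :
  multilinear f -> multilinear (fun s => f (bar s)).
Proof.
move=> fL u v a x y; rewrite !bar_cat /= (kos_linear _ a x y).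
exact: fL.
Qed.

Lemma multilinear_dl (W : lmodType K) (f : seq V -> W) s : multilinear f ->
  f (bar (map dl s)) = (-1) ^+ size s *: f (map (kos true) (bar s)).
Proof.
move=> fL; have -> : map dl s = map -%R (map (kos true) s) by rewrite -map_comp.
by rewrite bar_opp multilinear_opp // bar_kos size_map size_bar.
Qed.
End Koszul.

(** On homogeneous words both sides are multiples of [f s], whose degree is that of the word plus
    [e (size s)]; multilinearity extends this to all words. *)
Lemma deg_words_kos (K : fieldType) (V W : gradedType K) (e : nat -> int)
    (f : seq V -> W) b s : multilinear f -> deg_words e f ->
  kos b (f s) = (-1) ^+ (b && par (e (size s))) *: f (map (kos b) s).
Proof.
move=> fL fd; move: s; apply: multilinear_homog_eq.
- exact: multilinear_comp (kos_linear _) fL.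
- apply: (@multilinear_size _ _ _ (fun n => (-1) ^+ (b && par (e n)))
            (fun s => f (map (kos b) s))).
  exact: multilinear_map (kos_linear _) fL.
move=> ds s hs; rewrite (kosE _ (fd _ _ hs)) parD.
have -> : f (map (kos b) s) = (-1) ^+ (b && par (\sum_(d <- ds) d)) *: f s.
  rewrite -[map _ s]cat0s -[X in _ *: f X]cat0s.
  elim: ds s [::] hs => [|d ds IH] [|x s] u //=.
    by rewrite big_nil andbF expr0 scale1r.
  move=> /andP[hx hs]; rewrite (kosE _ hx) (linZ _ _ (fL _ _)) -cat_rcons (IH _ _ hs).
  rewrite cat_rcons scalerA -signr_addb big_cons parD.
  by case: (b) (par d) (par _) => [] [] [].
rewrite scalerA -signr_addb; congr (_ ^+ _ *: _).
by case: b (par _) (par _) => [] [] [].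
Qed.

(** * Splittings and block decompositions of words *)
Section Splittings.
Variables (T : Type) (W : zmodType).
Implicit Types (s u v : seq T).

(** Summing over factorizations of a word, empty factors included, replaces index arithmetic by
    regrouping of words. *)
Fixpoint splits s : seq (seq T * seq T) :=
  ([::], s) :: if s is a :: s' then [seq (a :: uv.1, uv.2) | uv <- splits s'] else [::].

Lemma splits_cons a s (G : seq T -> seq T -> W) :
  \sum_(uv <- splits (a :: s)) G uv.1 uv.2 =
  G [::] (a :: s) + \sum_(uv <- splits s) G (a :: uv.1) uv.2.
Proof. by rewrite big_cons big_map. Qed.

Lemma splitsE s (G : seq T -> seq T -> W) :
  \sum_(uv <- splits s) G uv.1 uv.2 = \sum_(p < (size s).+1) G (take p s) (drop p s).
Proof.
elim: s G => [|a s IH] G; first by rewrite big_ord1 big_seq1.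
by rewrite splits_cons (IH (fun u v => G (a :: u) v)) [RHS]big_ord_recl.
Qed.

(** Both sides run over the factorizations of [s] into three words. *)
Lemma splits_assoc s (G : seq T -> seq T -> seq T -> W) :
  \sum_(uv <- splits s) \sum_(xy <- splits uv.2) G uv.1 xy.1 xy.2 =
  \sum_(uv <- splits s) \sum_(xy <- splits uv.1) G xy.1 xy.2 uv.2.
Proof.
elim: s G => [|a s IH] G; first by rewrite !big_seq1 /= ?big_seq1.
rewrite (splits_cons _ _ (fun u v => \sum_(xy <- splits v) G u xy.1 xy.2)).
rewrite (splits_cons _ _ (fun u v => \sum_(xy <- splits u) G xy.1 xy.2 v)).
rewrite splits_cons big_seq1 /= -addrA; congr (_ + _).
rewrite (IH (fun u v w => G (a :: u) v w)) -big_split; apply: eq_bigr => uv _ /=.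
by rewrite big_cons big_map.
Qed.

(** The cut between [s] and [t] occurs twice on the right, whence the extra term on the left. *)
Lemma splits_cat s t (G : seq T -> seq T -> W) :
  \sum_(uv <- splits (s ++ t)) G uv.1 uv.2 + G s t =
  \sum_(uv <- splits s) G uv.1 (uv.2 ++ t) + \sum_(uv <- splits t) G (s ++ uv.1) uv.2.
Proof.
elim: s G => [|a s IH] G; first by rewrite big_seq1 addrC.
rewrite cat_cons !(splits_cons, splits_cons _ _ (fun u v => G u (v ++ t))).
by rewrite -!addrA; congr (_ + _); rewrite (IH (fun u v => G (a :: u) v)).
Qed.

Lemma eq_splits s (F G : seq T * seq T -> W) :
  (forall u v, s = u ++ v -> F (u, v) = G (u, v)) ->
  \sum_(uv <- splits s) F uv = \sum_(uv <- splits s) G uv.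
Proof.
move=> FG; transitivity (\sum_(uv <- splits s) F (uv.1, uv.2)).
  by apply: eq_bigr => -[].
rewrite (splitsE _ (fun u v => F (u, v))).
transitivity (\sum_(uv <- splits s) G (uv.1, uv.2)); last by apply: eq_bigr => -[].
rewrite (splitsE _ (fun u v => G (u, v))).
by apply: eq_bigr => p _; rewrite FG ?cat_take_drop.
Qed.

End Splittings.

Section Decompositions.
Variables (T : Type) (W : zmodType).
Implicit Types (s u v : seq T).

(** The decompositions of [s] into consecutive nonempty blocks. *)
Fixpoint decs s : seq (seq (seq T)) :=
  if s is a :: s' then
    flatten [seq ([:: a] :: d) :: (if d is b :: d' then [:: (a :: b) :: d'] else [::])
            | d <- decs s']
  else [:: [::]].

Lemma decs_cons a s (G : seq (seq T) -> W) :
  \sum_(d <- decs (a :: s)) G d =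
  \sum_(uv <- splits s) \sum_(d <- decs uv.2) G ((a :: uv.1) :: d).
Proof.
elim: s a G => [|b s IH] a G; first by rewrite !big_seq1 /= ?big_seq1.
rewrite [decs _]/= -/(decs (b :: s)) big_flatten /= big_map.
(* [G'] carries the terms in which [a] joins the first block of a decomposition of [b :: s]. *)
pose G' d := if d is b :: d' then G ((a :: b) :: d') else 0.
rewrite (eq_bigr (fun d => G ([:: a] :: d) + G' d)); last first.
  by move=> [|c d] _; rewrite ?big_seq1 ?addr0 // big_cons big_seq1.
rewrite big_split /= (splits_cons _ _ (fun u v => \sum_(d <- decs v) G ((a :: u) :: d))).
by rewrite (IH b G').
Qed.

(** A cut between two blocks amounts to a cut of the word followed by decompositions of both pieces.
    The first block is split off; what remains is an arbitrary suffix, so the induction is on the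
    length. *)
Lemma decs_splits s (G : seq (seq T) -> seq (seq T) -> W) :
  \sum_(d <- decs s) \sum_(xy <- splits d) G xy.1 xy.2 =
  \sum_(uv <- splits s) \sum_(d <- decs uv.1) \sum_(e <- decs uv.2) G d e.
Proof.
have [n] := ubnP (size s); elim: n s G => // n IH [|a s] G lts.
  by rewrite !big_seq1 /= ?big_seq1.
rewrite decs_cons.
rewrite (splits_cons _ _ (fun u v => \sum_(d <- decs u) \sum_(e <- decs v) G d e)).
rewrite big_seq1 decs_cons.
under [X in _ = _ + X]eq_bigr do rewrite decs_cons.
rewrite -(splits_assoc s (fun x y z =>
  \sum_(d <- decs y) \sum_(e <- decs z) G ((a :: x) :: d) e)) -big_split.
apply: eq_splits => v w svw /=.
rewrite -(IH w (fun x y => G ((a :: v) :: x) y)); last first.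
  by move: lts; rewrite svw /= size_cat; lia.
by rewrite -big_split; apply: eq_bigr => d _; rewrite splits_cons.
Qed.

(** The letter [a] lies in exactly one block; the blocks before it decompose a prefix of [u], those
    after it a suffix of [w]. *)
Lemma decs_cat_cons u a w (G : seq (seq T) -> W) :
  \sum_(d <- decs (u ++ a :: w)) G d =
  \sum_(xy <- splits u) \sum_(zt <- splits w)
    \sum_(d <- decs xy.1) \sum_(e <- decs zt.2) G (d ++ (xy.2 ++ a :: zt.1) :: e).
Proof.
have [n] := ubnP (size u); elim: n u G => // n IH [|b u] G ltu.
  by rewrite big_seq1 decs_cons; apply: eq_bigr => zt _; rewrite big_seq1.
rewrite cat_cons decs_cons.
rewrite (splits_cons _ _ (fun x y => \sum_(zt <- splits w)
  \sum_(d <- decs x) \sum_(e <- decs zt.2) G (d ++ (y ++ a :: zt.1) :: e))).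
(* The first block ends within [u] or after [a]. The cut right before [a] is counted twice by
   [splits_cat], and the surplus cancels. *)
have := splits_cat u (a :: w) (fun x y => \sum_(d <- decs y) G ((b :: x) :: d)).
rewrite (splits_cons _ _ (fun x y => \sum_(d <- decs y) G ((b :: u ++ x) :: d))).
rewrite cats0 addrA [RHS]addrAC => /addIr ->.
rewrite addrC; congr (_ + _).
  by apply: eq_bigr => zt _; rewrite big_seq1.
under [RHS]eq_bigr => xy _ do under eq_bigr do rewrite decs_cons.
under [RHS]eq_bigr => xy _ do rewrite exchange_big.
rewrite -(splits_assoc u (fun x y z => \sum_(zt <- splits w) \sum_(d <- decs y)
  \sum_(e <- decs zt.2) G ((b :: x) :: d ++ (z ++ a :: zt.1) :: e))).
apply: eq_splits => x y uxy /=.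
rewrite (IH y) //.
by move: ltu; rewrite uxy /= size_cat; lia.
Qed.
End Decompositions.

Section MapSplittings.
Variables (T U : Type) (W : zmodType) (h : T -> U).

Lemma splits_map s (G : seq U -> seq U -> W) :
  \sum_(uv <- splits (map h s)) G uv.1 uv.2 =
  \sum_(uv <- splits s) G (map h uv.1) (map h uv.2).
Proof.
rewrite splitsE (splitsE _ (fun u v => G (map h u) (map h v))) size_map.
by apply: eq_bigr => p _; rewrite map_take map_drop.
Qed.

Lemma decs_map s : decs (map h s) = map (map (map h)) (decs s).
Proof.
elim: s => //= a s ->; rewrite map_flatten -!map_comp; congr flatten.
by apply: eq_map => -[|b d].
Qed.
End MapSplittings.

(** * Compositions of a number and reindexing of sums *)

Fixpoint comps n : seq (seq nat) :=
  if n is n'.+1 then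
    flatten [seq (1%N :: c) :: (if c is k :: c' then [:: k.+1 :: c'] else [::])
            | c <- comps n']
  else [:: [::]].

(** [comps] follows the recursion of [decs] with every block replaced by its length. *)
Lemma decs_reshape (T : Type) (s : seq T) :
  decs s = [seq reshape c s | c <- comps (size s)].
Proof.
elim: s => //= a s ->; rewrite map_flatten -!map_comp; congr flatten.
by apply: eq_map => -[|k c] /=; rewrite ?take0 ?drop0.
Qed.

Lemma mem_comps n c : (c \in comps n) = is_composition n c.
Proof.
elim: n c => [|n IH] c.
  by case: c => [|[|k] c]; rewrite inE /is_composition /= ?inE ?andbF.
apply/flattenP/idP => [[e /mapP[d]]|].
  rewrite IH => /andP[d0 /eqP <-] ->; rewrite !inE => /orP[/eqP->|].
    by rewrite /is_composition inE negb_or d0 /=.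
  case: d d0 => [|k d] //; rewrite inE negb_or => /andP[_ d0]; rewrite inE => /eqP->.
  by rewrite /is_composition inE negb_or d0 /= addSn.
case: c => [|[|[|k]] c] // /andP[]; rewrite inE negb_or /= => c0 /eqP[sc].
  exists ((1%N :: c) :: (if c is k :: c' then [:: k.+1 :: c'] else [::])).
    by apply/mapP; exists c => //; rewrite IH /is_composition c0 -sc /=.
  by rewrite inE eqxx.
exists [:: 1%N :: k.+1 :: c; k.+2 :: c].
  apply/mapP; exists (k.+1 :: c) => //.
  by rewrite IH /is_composition inE negb_or c0 /= -sc.
by rewrite !inE eqxx orbT.
Qed.

Lemma uniq_comps n : uniq (comps n).
Proof.
elim: n => //= n; set g := (fun c => _).
have c0 c : c \in comps n -> 0%N \notin c by rewrite mem_comps => /andP[].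
elim: (comps n) c0 => // c r IH c0 /andP[cr ur].
rewrite -[flatten _]/(g c ++ flatten (map g r)).
(* A new composition determines the one it comes from: remove a leading 1, or else lower the first
   part by one. *)
have gK d e : d \in c :: r -> e \in g d ->
    d = if e is 1%N :: e' then e' else if e is k :: e' then k.-1 :: e' else [::].
  move=> /c0; case: d => [|[|k] d] //= d0; rewrite !inE.
    by move/eqP->.
  by case/orP=> /eqP->.
rewrite cat_uniq IH // => [|d dr]; last by apply: c0; rewrite inE dr orbT.
rewrite andbT; apply/andP; split.
  case: c c0 {cr gK} => [|k c] // c0.
  rewrite cons_uniq inE andbT; apply/eqP => -[k0 _].
  by have := c0 _ (mem_head _ _); rewrite inE -k0.
apply/hasPn => e /flattenP[_ /mapP[d dr ->] eg]; apply: contra cr => /= ec.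
by rewrite (gK c e) ?mem_head // -(gK d e) // inE dr orbT.
Qed.

Section Sums.
Variable W : zmodType.

(** A composition of [n] has at most [n] parts, each at most [n], so the bounds on the tuples lose
    nothing. *)
Lemma sum_comps n (G : seq nat -> W) :
  \sum_(l < n.+1) \sum_(i : l.-tuple 'I_n.+1 | is_composition n (map val i)) G (map val i)
  = \sum_(c <- comps n) G c.
Proof.
transitivity (\sum_(l < n.+1) \sum_(c <- comps n | size c == l) G c).
  apply: eq_bigr => l _.
  rewrite -[in RHS]big_filter.
  rewrite (eq_bigr (fun i : l.-tuple 'I_n.+1 => G (map val (tval i)))) //.
  rewrite -[in LHS]big_filter -(big_map (fun i : l.-tuple 'I_n.+1 => map val (tval i)) xpredT G).
  apply: perm_big; apply: uniq_perm.
  - rewrite map_inj_uniq ?filter_uniq ?index_enum_uniq //.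
    by move=> i j /(inj_map val_inj) /val_inj.
  - by rewrite filter_uniq ?uniq_comps.
  move=> c; rewrite mem_filter mem_comps; apply/mapP/andP => [[i]|[/eqP cl cn]].
    by rewrite mem_filter => /andP[ci _] ->; rewrite size_map size_tuple eqxx.
  have lec k : k \in c -> (k < n.+1)%N.
    have /andP[_ /eqP <-] := cn; rewrite ltnS.
    elim: (c) => //= j d IH; rewrite inE => /orP[/eqP->|/IH]; lia.
  have ec : map val (map (inord : nat -> 'I_n.+1) c) = c.
    rewrite -map_comp -[RHS]map_id; apply/eq_in_map => k /lec kn /=.
    by rewrite inordK.
  have sl : size (map (inord : nat -> 'I_n.+1) c) == l by rewrite size_map cl.
  by exists (Tuple sl); rewrite ?mem_filter ?mem_index_enum /= ec // andbT.
under eq_bigr do rewrite big_mkcond.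
rewrite exchange_big big_seq [RHS]big_seq; apply: eq_bigr => c.
rewrite mem_comps => /andP[c0 /eqP sc] /=.
have szc : (size c < n.+1)%N.
  rewrite ltnS -sc; elim: (c) c0 => //= k d IH; rewrite inE negb_or => /andP[k0 /IH]; lia.
by rewrite -big_mkcond /= (big_pred1 (Ordinal szc)).
Qed.

Lemma sum_triples (n : nat) (P Q : pred nat) (G : nat -> nat -> nat -> W) :
  \sum_(p < n.+1) \sum_(q < n.+1) \sum_(r < n.+1 | [&& (p + q + r == n)%N, P q & Q r])
    G p q r =
  \sum_(p < n.+1) \sum_(q < (n - p).+1 | P q && Q (n - p - q)%N) G p q (n - p - q)%N.
Proof.
apply: eq_bigr => p _; have pn := ltn_ord p.
rewrite (eq_bigr (fun q : 'I_n.+1 => if (q < (n - p).+1)%N && (P q && Q (n - p - q)%N)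
   then G p q (n - p - q)%N else 0)); last first.
  move=> q _; have rn : (n - p - q < n.+1)%N by lia.
  case: ifP => [/andP[qp PQ]|PQ].
    rewrite (big_pred1 (Ordinal rn)) // => r /=; apply/idP/eqP => [/and3P[/eqP e _ _]|->].
      by apply: val_inj => /=; lia.
    by rewrite /= PQ andbT; apply/eqP; lia.
  rewrite big_pred0 // => r; apply: contraFF PQ => /and3P[/eqP e -> Qr].
  have -> : (n - p - q = r)%N by lia.
  by rewrite Qr andbT; lia.
rewrite -big_mkcond /= (big_ord_widen_cond n.+1 (fun q => P q && Q (n - p - q)%N)
  (fun q => G p q (n - p - q)%N)) ?ltnS ?leq_subr //.
by apply: eq_bigl => q; rewrite andbC.
Qed.
End Sums.

Section MoreSums.
Variable W : zmodType.

(** In the module equation the last slot holds the module element, so the third index is one more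
    than the number of letters to the right of the operation. *)
Lemma sum_triples_pos (n : nat) (P : pred nat) (G : nat -> nat -> nat -> W) :
  \sum_(p < n.+2) \sum_(q < n.+2)
    \sum_(r < n.+2 | [&& (p + q + r == n.+1)%N, P q & (0 < r)%N]) G p q r =
  \sum_(p < n.+1) \sum_(q < (n - p).+1 | P q) G p q (n - p - q).+1.
Proof.
rewrite (sum_triples n.+1 P (leq 1)) big_ord_recr /= [X in _ + X]big1 ?addr0; last first.
  by move=> q /andP[_]; lia.
apply: eq_bigr => p _; have pn := ltn_ord p.
rewrite subSn // big_mkcond big_ord_recr /= subnn andbF addr0 -big_mkcond /=.
apply: eq_big => [q|q _]; have qn := ltn_ord q; last by congr G; lia.
by rewrite subn_gt0 qn andbT.
Qed.

Lemma sum_pairs_pos (n : nat) (G : nat -> nat -> W) :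
  \sum_(a < n.+2) \sum_(b < n.+2 | (a + b == n.+1)%N && (0 < b)%N) G a b =
  \sum_(a < n.+1) G a (n - a).+1.
Proof.
rewrite big_ord_recr /= [X in _ + X]big_pred0 ?addr0; last by move=> b; lia.
apply: eq_bigr => a _; have an := ltn_ord a.
have lt : ((n - a).+1 < n.+2)%N by lia.
rewrite (big_pred1 (Ordinal lt)) // => b; apply/andP/eqP => [[/eqP e _]|->].
  by apply: val_inj => /=; lia.
by split=> //=; apply/eqP; lia.
Qed.

Lemma splitsE_cond (T : Type) (s : seq T) (P : pred (seq T)) (G : seq T -> seq T -> W) :
  \sum_(uv <- splits s | P uv.1) G uv.1 uv.2 =
  \sum_(p < (size s).+1 | P (take p s)) G (take p s) (drop p s).
Proof.
rewrite big_mkcond [RHS]big_mkcond.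
exact: (splitsE s (fun u v => if P u then G u v else 0)).
Qed.
End MoreSums.

(** * Structure equations in shifted form *)

Section Bar.
Variables (K : fieldType) (V : gradedType K) (m : seq V -> V).
Hypotheses (mL : multilinear m) (md : deg_words (fun k => 2 - k%:Z) m).

(** With p, q, r the lengths of [u], [v], [w]: (-1)^p comes from the p maps [dl], and (-1)^(qr) from
    pulling the r-fold sign on the output of m_q, of degree 2 - q, onto its inputs. *)
Lemma bar_term (W : lmodType K) (g : seq V -> W) u v w : multilinear g ->
  (-1) ^+ (size u + size v * size w) *:
    g (map (koszul (2 - (size v)%:Z)) (map (kos (odd (size v + size w))) (bar u))
       ++ m (map (kos (odd (size w))) (bar v)) :: bar w) =
  g (bar (map (@dl K V) u ++ m (bar v) :: w)).
Proof.
move=> gL; rewrite bar_cat /=.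
have gL' : multilinear (fun s => g (map (kos (~~ odd (size w))) s
    ++ kos (odd (size w)) (m (bar v)) :: bar w)).
  exact: multilinear_map (kos_linear _) (multilinear_suffix _ gL).
rewrite (multilinear_dl _ gL') map_kos_comp (deg_words_kos _ _ mL md) (linZ _ _ (gL _ _)).
rewrite scalerA (eq_map (koszul_kos _)) map_kos_comp size_bar parD parN !par_nat oddD.
rewrite exprD -(signr_odd _ (_ * _)) oddM; congr (_ * _ *: g _).
  by case: (odd (size v)) (odd (size w)) => [] [].
rewrite [X in kos X](_ : _ = ~~ odd (size w) (+) true) //.
by rewrite oddD; case: (odd (size v)) (odd (size w)) => [] [].
Qed.

Lemma bar_sum (W : lmodType K) (g : seq V -> W) s : multilinear g ->
  let n := size s in let S := bar s in
  \sum_(p < n.+1) \sum_(q < (n - p).+1 | (0 < q)%N)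
    (-1) ^+ (p + q * (n - p - q)) *:
    g (map (koszul (2 - q%:Z)) (take p S) ++ m (take q (drop p S)) :: drop (p + q) S) =
  \sum_(ut <- splits s) \sum_(vw <- splits ut.2 | (0 < size vw.1)%N)
    g (bar (map (@dl K V) ut.1 ++ m (bar vw.1) :: vw.2)).
Proof.
move=> gL n S; rewrite (splitsE s (fun u t => \sum_(vw <- splits t | (0 < size vw.1)%N)
  g (bar (map (@dl K V) u ++ m (bar vw.1) :: vw.2)))).
apply: eq_bigr => p _; have pn := ltn_ord p.
rewrite (splitsE_cond _ (fun v => (0 < size v)%N)
  (fun v w => g (bar (map (@dl K V) (take p s) ++ m (bar v) :: w)))) size_drop -/n.
apply: eq_big => [q|q q0]; have qn := ltn_ord q.
  by rewrite size_takel ?size_drop.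
set u := take p s; set v := take q (drop p s); set w := drop q _.
have su : size u = p by rewrite size_takel.
have sv : size v = q by rewrite size_takel ?size_drop.
have sw : size w = (n - p - q)%N by rewrite !size_drop.
have eS : S = map (kos (odd (size v + size w))) (bar u)
            ++ map (kos (odd (size w))) (bar v) ++ bar w.
  by rewrite -bar_cat -size_cat -bar_cat !cat_take_drop.
rewrite -bar_term // su sv sw -[(p + q)%N]addnC -drop_drop eS.
rewrite take_size_cat ?drop_size_cat ?size_map ?size_bar // take_size_cat ?drop_size_cat //.
  by rewrite sv sw.
by rewrite size_map size_bar.
Qed.
End Bar.

(** [m] is not required to satisfy the A-infinity relations: that C^* is an A-infinity
    algebra is not needed for it to act on comodules. *)
Definition lmodule_lhs (K : fieldType) (V M : gradedType K) (m : seq V -> V)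
    (act : seq V -> M -> M) s x : M :=
  let n := (size s).+1 in
  \sum_(p < n.+1) \sum_(q < n.+1)
    \sum_(r < n.+1 | [&& (p + q + r == n)%N, (0 < q)%N & (0 < r)%N])
    (-1) ^+ (p + q * r) *:
    act (map (koszul (2 - q%:Z)) (take p s)
         ++ m (take q (drop p s)) :: drop (p + q) s) x
  + \sum_(a < n.+1) \sum_(b < n.+1 | (a + b == n)%N && (0 < b)%N)
    (-1) ^+ a *:
    act (map (koszul (2 - b%:Z)) (take a s)) (act (drop a s) x).

(** The module element counts as a last letter, so each letter of [s] has one more letter behind it;
    this is the extra [kos true]. *)
Definition bar_act (K : fieldType) (V M : gradedType K) (act : seq V -> M -> M) s x :=
  act (map (kos true) (bar s)) x.

Lemma bar_act_multilinear (K : fieldType) (V M : gradedType K) (act : seq V -> M -> M) x :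
  multilinear (act^~ x) -> multilinear ((bar_act act)^~ x).
Proof.
move=> actL; apply: (multilinear_bar (f := fun s => act (map (kos true) s) x)).
exact: multilinear_map (kos_linear _) actL.
Qed.

Lemma lmodule_lhs_bar (K : fieldType) (V M : gradedType K) (m : seq V -> V)
    (act : seq V -> M -> M) s x :
  multilinear m -> deg_words (fun k => 2 - k%:Z) m ->
  (forall y, multilinear (act^~ y)) ->
  lmodule_lhs m act (map (kos true) (bar s)) x =
  \sum_(ut <- splits s) \sum_(vw <- splits ut.2 | (0 < size vw.1)%N)
    bar_act act (map (@dl K V) ut.1 ++ m (bar vw.1) :: vw.2) x
  + \sum_(uv <- splits s) bar_act act (map (@dl K V) uv.1) (bar_act act uv.2 x).
Proof.
move=> mL md actL; rewrite /lmodule_lhs size_map size_bar; cbv zeta.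
have gL : multilinear (fun s => act (map (kos true) s) x).
  exact: multilinear_map (kos_linear _) (actL x).
congr (_ + _).
  rewrite (sum_triples_pos _ (leq 1) (fun p q r => (-1) ^+ (p + q * r) *:
    act (map (koszul (2 - q%:Z)) (take p (map (kos true) (bar s)))
      ++ m (take q (drop p (map (kos true) (bar s))))
      :: drop (p + q) (map (kos true) (bar s))) x)) -(bar_sum mL md s gL).
  apply: eq_bigr => p _; apply: eq_big => // q _.
  (* The third index exceeds the number of remaining letters by one. The resulting factor (-1)^q is
     the sign of pulling [kos true] through m_q. *)
  rewrite -!map_take -!map_drop -!map_take mulnS addnCA [(q + (_ + _))%N]addnC exprD -scalerA.
  rewrite map_cat /= (deg_words_kos _ _ mL md) (linZ _ _ (actL x _ _)).
  have -> : size (take q (drop p (bar s))) = q.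
    have := ltn_ord q; have := ltn_ord p.
    by rewrite size_take_min size_drop size_bar => ? ?; apply/minn_idPl; lia.
  rewrite -!map_comp parD parN par_nat andTb !scalerA !signr_odd.
  congr (_ *: act (_ ++ _) x).
  by apply: eq_map => y /=; rewrite !koszul_kos !kos_comp addbC.
rewrite (sum_pairs_pos _ (fun a b => (-1) ^+ a *:
  act (map (koszul (2 - b%:Z)) (take a (map (kos true) (bar s))))
    (act (drop a (map (kos true) (bar s))) x))).
rewrite (splitsE _ (fun u v => bar_act act (map (@dl K V) u) (bar_act act v x))).
apply: eq_bigr => a _; have an := ltn_ord a.
rewrite /bar_act -[X in map (kos true) (bar X)](cat_take_drop a s) bar_cat map_cat.
have st : size (take a s) = a by rewrite size_takel.
rewrite take_size_cat ?drop_size_cat ?size_map ?size_bar //.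
set y := act _ x.
rewrite (multilinear_dl _ (multilinear_map (kos_linear true) (actL _))) st.
congr (_ *: act _ _); rewrite -!map_comp; apply: eq_map => z /=.
rewrite koszul_kos !kos_comp parD parN !par_nat size_drop /=.
by congr kos; case: (odd _).
Qed.

(** * Block decompositions and the signs of a morphism *)

Section Blocks.
Variables (K : fieldType) (A B : gradedType K) (f : seq A -> B).
Hypotheses (fL : multilinear f) (fd : deg_words (fun k => 1 - k%:Z) f).

Lemma comp_sign_cons t i c :
  comp_sign t.+1 (i :: c) = (t * i.-1 + comp_sign t c)%N.
Proof.
rewrite /comp_sign big_ord_recl /= subn0; congr addn.
by apply: eq_bigr => j _; rewrite /= /bump /= -subn1 subnDA subn1.
Qed.

Lemma par_sum_comp c : par (\sum_(j <- c) (1 - j%:Z)) = odd (size c) (+) odd (sumn c).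
Proof.
elim: c => [|i c IH]; first by rewrite big_nil.
rewrite big_cons parD IH parD parN par_nat /= oddD.
by case: (odd i) (odd (size c)) (odd (sumn c)) => [] [] [].
Qed.

(** [e] counts the factors after the blocks: 0 for a morphism, 1 for a restriction, where the
    identity of the module follows. If t factors follow a block of length i, pulling the t-fold sign
    through f_i, of degree 1 - i, gives (-1)^(t(i-1)), the share of this block in [comp_sign]. *)
Lemma map_blocks_bar (W : lmodType K) (g : seq B -> W) e c s : multilinear g ->
  0%N \notin c -> sumn c = size s ->
  (-1) ^+ comp_sign (size c + e) c *: g (map_blocks f c (map (kos (odd e)) (bar s))) =
  g (map (kos (odd e)) (bar (map (fun u => f (bar u)) (reshape c s)))).
Proof.
elim: c s g => [|i c IH] s g gL /=.
  by rewrite /comp_sign big1 ?expr0 ?scale1r // => j _; rewrite nth_nil muln0.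
rewrite inE negb_or => /andP[i0 c0] sc.
have ss : sumn c = size (drop i s) by rewrite size_drop -sc addKn.
have si : size (take i s) = i by rewrite size_takel // -sc leq_addr.
rewrite -[in LHS](cat_take_drop i s) bar_cat map_cat.
rewrite take_size_cat ?drop_size_cat ?size_map ?size_bar //.
rewrite addSn comp_sign_cons exprD -scalerA.
set z := f _; rewrite (IH _ (fun t => g (z :: t))) //; last exact: multilinear_head.
rewrite {}/z -ss -2!map_comp size_reshape.
set X := map _ (bar (map _ _)).
rewrite (_ : map _ _ = map (kos (odd e (+) odd (size c))) (bar (take i s))); last first.
  apply: eq_map => z /=; rewrite koszul_kos !kos_comp par_sum_comp; congr kos.
  by case: (odd e) (odd (size c)) (odd (sumn c)) => [] [] [].
rewrite kos_comp (deg_words_kos _ _ fL fd) size_bar si.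
rewrite (linZ _ _ (gL [::] X)) /= parD parN !par_nat.
rewrite -(signr_odd _ (_ * _)) oddM oddD addbC.
(* Since [i] is positive, [i.-1] has the parity of 1 - i; the truncated predecessor of 0 would
   not. *)
by case: (i) i0 => // j _ /=; rewrite negbK.
Qed.
End Blocks.

(** The left side chooses the inner word [v] first and then cuts what lies around it; the right side
    cuts off the outer words first and then divides the middle segment [y ++ v ++ z]. *)
Lemma splits_assoc5 (T : Type) (W : zmodType) (s : seq T)
    (G : seq T -> seq T -> seq T -> seq T -> seq T -> W) :
  \sum_(ur <- splits s) \sum_(vw <- splits ur.2)
    \sum_(xy <- splits ur.1) \sum_(zt <- splits vw.2) G xy.1 xy.2 vw.1 zt.1 zt.2 =
  \sum_(xm <- splits s) \sum_(nt <- splits xm.2)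
    \sum_(yq <- splits nt.1) \sum_(vz <- splits yq.2) G xm.1 yq.1 vz.1 vz.2 nt.2.
Proof.
under eq_bigr do rewrite exchange_big.
rewrite -(splits_assoc s (fun x y r =>
  \sum_(vw <- splits r) \sum_(zt <- splits vw.2) G x y vw.1 zt.1 zt.2)).
apply: eq_bigr => xm _.
rewrite -(splits_assoc _ (fun y q t => \sum_(vz <- splits q) G xm.1 y vz.1 vz.2 t)).
apply: eq_bigr => yr _.
by rewrite (splits_assoc _ (fun v z t => G xm.1 yr.1 v z t)).
Qed.

(** * Restriction of scalars *)
Section Restriction.
Variables (K : fieldType) (A B M : gradedType K).
Variables (mA : seq A -> A) (mB : seq B -> B) (f : seq A -> B) (act : seq B -> M -> M).
Hypotheses (mAL : multilinear mA) (mAd : deg_words (fun k => 2 - k%:Z) mA).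
Hypotheses (mBL : multilinear mB) (mBd : deg_words (fun k => 2 - k%:Z) mB).
Hypothesis fM : is_ainf_morphism mA mB f.
Hypotheses (actL : forall x, multilinear (act^~ x)) (act_linear : forall s, linear (act s)).

Let fL : multilinear f. Proof. by case: fM. Qed.
Let fd : deg_words (fun k => 1 - k%:Z) f. Proof. by case: fM. Qed.

Let F u := f (bar u).

(** After the shift [f] has degree 0: the factor (-1)^k from k letters and the sign of passing f_k,
    of degree 1 - k, leave just the -1 in [dl]. *)
Lemma bar_morphism_dl u : F (map (@dl K A) u) = dl (F u).
Proof.
rewrite /F multilinear_dl // /dl (deg_words_kos _ _ fL fd) size_bar -scaleNr.
congr (_ *: _); rewrite parD parN par_nat /= -[LHS]signr_odd.
by case: (odd _); rewrite ?opprK.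
Qed.

Lemma bar_morphism_eq s :
  \sum_(ut <- splits s) \sum_(vw <- splits ut.2 | (0 < size vw.1)%N)
    F (map (@dl K A) ut.1 ++ mA (bar vw.1) :: vw.2) =
  \sum_(d <- decs s | (0 < size d)%N) mB (bar (map F d)).
Proof.
case: s => [|a s]; first by rewrite big_seq1 /= !big_cons !big_nil.
have [_ _ _ fE] := fM.
rewrite -(bar_sum mAL mAd (a :: s) fL); cbv zeta.
have {}fE := fE (bar (a :: s)); rewrite size_bar in fE.
have {}fE := fE isT; cbv zeta in fE.
set n := size (a :: s) in fE *.
transitivity (\sum_(c <- comps n)
    (-1) ^+ comp_sign (size c) c *: mB (map_blocks f c (bar (a :: s)))).
  rewrite -sum_comps.
  transitivity (\sum_(t < n.+1 | (0 < t)%N)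
    \sum_(i : t.-tuple 'I_n.+1 | is_composition n (map val i))
      (-1) ^+ comp_sign t (map val i) *: mB (map_blocks f (map val i) (bar (a :: s)))).
    rewrite -fE.
    transitivity (\sum_(p < n.+1) \sum_(q < n.+1)
      \sum_(r < n.+1 | [&& (p + q + r == n)%N, (0 < q)%N & predT (nat_of_ord r)])
      (-1) ^+ (p + q * r) *: f (map (koszul (2 - q%:Z)) (take p (bar (a :: s)))
         ++ mA (take q (drop p (bar (a :: s)))) :: drop (p + q) (bar (a :: s)))).
      rewrite (sum_triples n (leq 1) predT (fun p q r => (-1) ^+ (p + q * r) *:
        f (map (koszul (2 - q%:Z)) (take p (bar (a :: s)))
         ++ mA (take q (drop p (bar (a :: s)))) :: drop (p + q) (bar (a :: s))))).
      by apply: eq_bigr => p _; apply: eq_bigl => q; rewrite andbT.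
    apply: eq_bigr => p _; apply: eq_bigr => q _; apply: eq_bigl => r.
    by rewrite andbT.
  rewrite big_mkcond; apply: eq_bigr => t _.
  (* A nonempty word has no decomposition into 0 blocks, so the condition on [t] loses nothing. *)
  case: (posnP t) => [t0|_]; last by apply: eq_bigr => i _; rewrite size_map size_tuple.
  rewrite big1 // => i; case/andP=> _ /eqP.
  by rewrite (size0nil (_ : size (map val i) = 0%N)) // size_map size_tuple.
rewrite decs_reshape big_map -/n [LHS]big_seq [RHS]big_seq_cond.
apply: eq_big => [c|c].
  rewrite size_reshape; case: c => [|k c]; last by rewrite andbT.
  by rewrite mem_comps andbF.
rewrite mem_comps => /andP[c0 /eqP sc].
have := map_blocks_bar fL fd 0 mBL c0 sc.
by rewrite addn0 !map_kos0.
Qed.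

Lemma restrict_bar s x :
  bar_act (restrict f act) s x = \sum_(d <- decs s) bar_act act (map F d) x.
Proof.
rewrite /bar_act /restrict size_map size_bar; set S := map _ (bar s).
transitivity (\sum_(c <- comps (size s))
    (-1) ^+ comp_sign (size c).+1 c *: act (map_blocks f c S) x).
  rewrite -sum_comps; apply: eq_bigr => l _; apply: eq_bigr => i _.
  by rewrite size_map size_tuple.
rewrite decs_reshape big_map [LHS]big_seq [RHS]big_seq; apply: eq_bigr => c.
rewrite mem_comps => /andP[c0 /eqP sc].
have := map_blocks_bar fL fd 1 (actL x) c0 sc.
by rewrite addn1.
Qed.

(** The varied letter lies in a single block; by the condition on [sumn c] the blocks cover the
    word, so no letter is dropped. *)
Lemma map_blocks_multilinear (W : lmodType K) (g : seq B -> W) c u v : multilinear g ->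
  sumn c = (size u + (size v).+1)%N -> linear (fun x => g (map_blocks f c (u ++ x :: v))).
Proof.
have aux1 (i a b t : nat) : (i + t)%N = (a + b.+1)%N -> (i < a)%N ->
  t = (a - i + b.+1)%N by lia.
have aux2 (i a b t : nat) : (i + t)%N = (a + b.+1)%N -> (a <= i)%N -> (i - a)%N = 0%N ->
  t = (0 + b.+1)%N by lia.
elim: c g u => [|i c IH] g u gL /= sc a x y; first by move: sc; rewrite addnS.
rewrite !take_cat !drop_cat; have [ltiu|leui] := ltnP i (size u).
  apply: (IH (fun t => g (_ :: t))); first exact: multilinear_head.
  by rewrite size_drop; exact: aux1.
case e: (i - size u)%N => [|k] /=.
  rewrite !cats0; apply: (IH (fun t => g (_ :: t)) [::]); first exact: multilinear_head.
  exact: aux2 e.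
have L := multilinear_map (koszul_linear (\sum_(j <- c) (1 - j%:Z))) fL.
by rewrite L; exact: (gL [::]).
Qed.

Lemma restrict_multilinear x : multilinear ((restrict f act)^~ x).
Proof.
move=> u v a y z; rewrite /restrict !size_cat /=.
rewrite scaler_sumr -big_split; apply: eq_bigr => l _ /=.
rewrite scaler_sumr -big_split; apply: eq_bigr => i /andP[_ /eqP si] /=.
rewrite (map_blocks_multilinear (actL x)) // scalerDr.
by rewrite !scalerA [a * _]mulrC.
Qed.

Lemma restrict_linear s : linear (restrict f act s).
Proof.
rewrite /restrict; apply: sum_linear => l; apply: sum_linear => i.
exact: scale_linear.
Qed.

Lemma map_blocks_homogs c ds s : homogs ds s -> sumn c = size s ->
  exists2 es, homogs es (map_blocks f c s) &
    \sum_(e <- es) e = \sum_(d <- ds) d + (size c)%:Z - (size s)%:Z.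
Proof.
elim: c ds s => [|i c IH] ds s hs /= sc.
  exists [::] => //; have := homogs_size hs; rewrite -sc.
  by move=> /size0nil ->; rewrite !big_nil.
have ss : sumn c = size (drop i s) by rewrite size_drop -sc addKn.
have [es hes ees] := IH _ _ (homogs_drop i hs) ss.
exists (\sum_(d <- take i ds) d + (1 - (size (take i s))%:Z) :: es) => /=.
  rewrite hes andbT -(size_map (koszul (\sum_(j <- c) (1 - j%:Z))) (take i s)).
  by apply/fd/homogs_koszul/homogs_take.
have si : size (take i s) = i by rewrite size_takel // -sc leq_addr.
rewrite big_cons ees -[in RHS](cat_take_drop i ds) big_cat /= si -ss -sc.
move: (\sum_(d <- take i ds) d) (\sum_(d <- drop i ds) d) => a b. rewrite PoszD; lia.
Qed.

Lemma size_map_blocks c s : size (map_blocks f c s) = size c.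
Proof. by elim: c s => //= i c IH s; rewrite IH. Qed.

Lemma restrict_deg ds s d x :
  (forall ds s d x, homogs ds s -> homog d x ->
    homog (\sum_(e <- ds) e + d + (2 - (size s).+1%:Z)) (act s x)) ->
  homogs ds s -> homog d x ->
  homog (\sum_(e <- ds) e + d + (2 - (size s).+1%:Z)) (restrict f act s x).
Proof.
move=> act_deg hs hx; apply: homog_sum => l _; apply: homog_sum => i /andP[_ /eqP si].
have [es hes ees] := map_blocks_homogs hs si.
apply: homogZ; have := act_deg _ _ _ _ hes hx.
rewrite ees; set e1 := _ + d + _; set e2 := _ + d + _; suff -> : e1 = e2 by [].
rewrite /e1 /e2 size_map_blocks; lia.
Qed.

Hypothesis act_eq : forall s x, lmodule_lhs mB act s x = 0.

Lemma restrict_eq s x : lmodule_lhs mA (restrict f act) s x = 0.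
Proof.
(* Every word is a shifted word, so the equation may be checked in shifted form. *)
have -> : s = map (kos true) (bar (bar (map (kos true) s))).
  by rewrite barK map_kos_comp map_kos0.
move: (bar (map (kos true) s)) => {}s.
rewrite (lmodule_lhs_bar _ _ mAL mAd restrict_multilinear).
pose Q x d b e := bar_act act (map (@dl K B) d ++ mB (bar b) :: e) x.
have bL y := bar_act_multilinear (actL y).
(* The left side is the sum over all decompositions [D] of the module equation for [act] on the
   blocks of [D], and each of these vanishes. *)
transitivity (\sum_(D <- decs s) lmodule_lhs mB act (map (kos true) (bar (map F D))) x);
  last by rewrite big1.
under [RHS]eq_bigr do rewrite lmodule_lhs_bar //.
rewrite big_split; congr (_ + _).
  (* [G] collects the terms where [mA] is applied to [v] inside the block made of [y], [v] and [z],
     while [a] and [t] are decomposed freely. *)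
  pose G a y v z t := if (0 < size v)%N then \sum_(d <- decs a) \sum_(e <- decs t)
    bar_act act (map (@dl K B) (map F d)
      ++ F (map (@dl K A) y ++ mA (bar v) :: z) :: map F e) x else 0.
  transitivity (\sum_(ur <- splits s) \sum_(vw <- splits ur.2)
    \sum_(xy <- splits ur.1) \sum_(zt <- splits vw.2) G xy.1 xy.2 vw.1 zt.1 zt.2).
    apply: eq_bigr => ut _; rewrite big_mkcond; apply: eq_bigr => vw _.
    rewrite /G; case: ifP => _; last by rewrite big1 // => xy _; rewrite big1.
    rewrite restrict_bar decs_cat_cons.
    rewrite (splits_map _ _ (fun a y => \sum_(zt <- splits vw.2) \sum_(d <- decs a)
      \sum_(e <- decs zt.2) bar_act act
        (map F (d ++ (y ++ mA (bar vw.1) :: zt.1) :: e)) x)).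
    apply: eq_bigr => ay _; apply: eq_bigr => zt _.
    rewrite decs_map big_map; apply: eq_bigr => d _; apply: eq_bigr => e _.
    rewrite map_cat -!map_comp /=; congr (bar_act act (_ ++ _) x).
    by apply: eq_map => u /=; exact: bar_morphism_dl.
  rewrite splits_assoc5.
  (* In [H], [mB] is applied to the group of blocks [b]; an empty group contributes nothing. *)
  pose H d b e := if (0 < size b)%N then Q x (map F d) (map F b) (map F e) else 0.
  transitivity (\sum_(am <- splits s) \sum_(d <- decs am.1) \sum_(nt <- splits am.2)
    \sum_(b <- decs nt.1) \sum_(e <- decs nt.2) H d b e).
    apply: eq_bigr => am _; rewrite [RHS]exchange_big; apply: eq_bigr => nt _.
    (* By linearity in one slot, the sum over all cuts of the middle segment moves inside the action
       and becomes one side of the morphism equation. *)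
    transitivity (\sum_(d <- decs am.1) \sum_(e <- decs nt.2) bar_act act
      (map (@dl K B) (map F d) ++ (\sum_(ut <- splits nt.1)
        \sum_(vw <- splits ut.2 | (0 < size vw.1)%N)
        F (map (@dl K A) ut.1 ++ mA (bar vw.1) :: vw.2)) :: map F e) x).
      under [RHS]eq_bigr => d _ do under eq_bigr => e _ do
        (rewrite (lin_sum _ _ _ (bL x _ _)); under eq_bigr do
          rewrite (lin_sum _ _ _ (bL x _ _)) big_mkcond).
      under [RHS]eq_bigr do rewrite exchange_big.
      rewrite [RHS]exchange_big; apply: eq_bigr => yq _.
      under [RHS]eq_bigr do rewrite exchange_big.
      rewrite [RHS]exchange_big; apply: eq_bigr => vz _.
      rewrite /G; case: ifP => // _.
      by rewrite big1 // => d _; rewrite big1.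
    apply: eq_bigr => d _; rewrite [RHS]exchange_big; apply: eq_bigr => e _.
    rewrite bar_morphism_eq (lin_sum _ _ _ (bL x _ _)) big_mkcond.
    by apply: eq_bigr => b _.
  (* Decompositions of three adjacent segments form one decomposition cut at two block
     boundaries. *)
  transitivity (\sum_(D <- decs s) \sum_(dr <- splits D) \sum_(be <- splits dr.2)
     H dr.1 be.1 be.2).
    rewrite (decs_splits _ (fun d r => \sum_(be <- splits r) H d be.1 be.2)).
    apply: eq_bigr => am _; apply: eq_bigr => d _.
    by rewrite (decs_splits _ (fun b e => H d b e)).
  apply: eq_bigr => D _.
  rewrite (splits_map _ _ (fun u t => \sum_(vw <- splits t | (0 < size vw.1)%N)
    bar_act act (map (@dl K B) u ++ mB (bar vw.1) :: vw.2) x)).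
  apply: eq_bigr => dr _; rewrite [RHS]big_mkcond.
  rewrite (splits_map _ _ (fun v w => if (0 < size v)%N then
    bar_act act (map (@dl K B) (map F dr.1) ++ mB (bar v) :: w) x else 0)).
  by apply: eq_bigr => be _; rewrite size_map.
(* The terms with two nested actions: a cut of the word with both pieces decomposed is a
   decomposition cut between blocks. *)
transitivity (\sum_(D <- decs s) \sum_(de <- splits D)
   bar_act act (map (@dl K B) (map F de.1)) (bar_act act (map F de.2) x)); last first.
  apply: eq_bigr => D _.
  by rewrite (splits_map _ _ (fun u v => bar_act act (map (@dl K B) u) (bar_act act v x))).
rewrite (decs_splits _ (fun d e =>
  bar_act act (map (@dl K B) (map F d)) (bar_act act (map F e) x))).
apply: eq_bigr => uv _; rewrite !restrict_bar decs_map big_map; apply: eq_bigr => d _.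
have BL u : linear (bar_act act u) by exact: act_linear.
rewrite (lin_sum _ _ _ (BL _)); apply: eq_bigr => e _.
congr (bar_act act _ _); rewrite -!map_comp; apply: eq_map => u /=.
exact: bar_morphism_dl.
Qed.
End Restriction.

(** * Comodules over C as modules over C^* *)
Section TensorInduction.
Variables (K : fieldType) (P V W : lmodType K).

Lemma tens_ind (Q : tens V -> Prop) :
  Q 0 -> (forall a s t, Q t -> Q (a *: tpure s + t)) -> forall t, Q t.
Proof. by move=> Q0 QS; exact: presented_ind. Qed.

Lemma tlift_comp (U : lmodType K) (h : W -> U) (f : seq V -> W) t :
  linear h -> multilinear f -> h (tlift f t) = tlift (fun s => h (f s)) t.
Proof.
move=> hL fL; have hfL : multilinear (fun s => h (f s)) by exact: multilinear_comp.
elim/tens_ind: t => [|a s t IH].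
  by rewrite !(lin0 (tlift_linear _)) // (lin0 hL).
by rewrite !(tlift_linear fL, tlift_linear hfL) hL IH !tlift_pure.
Qed.

Lemma tlift_param (U : lmodType K) (f : U -> seq V -> W) t :
  (forall s, linear (f^~ s)) -> (forall x, multilinear (f x)) ->
  linear (fun x => tlift (f x) t).
Proof.
move=> fU fL a x y; elim/tens_ind: t => [|b s t IH].
  by rewrite !(lin0 (tlift_linear _)) // scaler0 addr0.
rewrite !(tlift_linear (fL _)) IH !tlift_pure // fU !scalerDr !scalerA [b * a]mulrC.
by rewrite -!addrA; congr (_ + _); rewrite addrCA.
Qed.

Lemma ppure_infix_multilinear (z : P) (u v : seq V) :
  multilinear (fun s => ppure z (u ++ s ++ v)).
Proof.
have [_ pL] := ppure_pmultilinear P V.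
by move=> u1 v1 a x y; rewrite -!catA !cat_cons !(catA u u1); exact: pL.
Qed.

Lemma plift_comp (U : lmodType K) (h : W -> U) (f : P -> seq V -> W) t :
  linear h -> pmultilinear f -> h (plift f t) = plift (fun z s => h (f z s)) t.
Proof.
move=> hL fL; have hfL : pmultilinear (fun z s => h (f z s)).
  by case: fL => f1 f2; split=> [s a x y|z]; [rewrite f1 hL | exact: multilinear_comp].
elim/ptens_ind: t => [|a z s t IH].
  by rewrite !(lin0 (plift_linear _)) // (lin0 hL).
by rewrite !(plift_linear fL, plift_linear hfL) hL IH !plift_pure.
Qed.

Lemma plift_param (U : lmodType K) (f : U -> P -> seq V -> W) t :
  (forall z s, linear (fun x => f x z s)) -> (forall x, pmultilinear (f x)) ->
  linear (fun x => plift (f x) t).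
Proof.
move=> fU fL a x y; elim/ptens_ind: t => [|b z s t IH].
  by rewrite !(lin0 (plift_linear _)) // scaler0 addr0.
rewrite !(plift_linear (fL _)) IH !plift_pure // fU !scalerDr !scalerA [b * a]mulrC.
by rewrite -!addrA; congr (_ + _); rewrite addrCA.
Qed.

Lemma eq_plift (f g : P -> seq V -> W) t : pmultilinear f -> pmultilinear g ->
  (forall z s, f z s = g z s) -> plift f t = plift g t.
Proof.
move=> fL gL fg; elim/ptens_ind: t => [|a z s t IH].
  by rewrite !(lin0 (plift_linear _)).
by rewrite !(plift_linear fL, plift_linear gL) IH !plift_pure // fg.
Qed.
End TensorInduction.

(** * Evaluation of homogeneous functionals *)

Section HomogeneousFunctionals.
Variables (K : fieldType) (C : gradedType K).
Implicit Types (phi : gdual C) (Phi Psi : seq (gdual C)) (x : C) (s : seq C).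

Lemma gdual_homogP n phi : reflect (forall x, phi (gcomp (- n) x) = phi x) (homog n phi).
Proof.
apply: (iffP eqP) => [e x|e]; first by rewrite -[in RHS]e.
by apply: gdual_ext => x; exact: e.
Qed.

Lemma gdual_homog0 n m phi x : homog n phi -> homog m x -> m != - n -> phi x = 0.
Proof.
move=> /gdual_homogP e /eqP hx mn; rewrite -e -hx gcompK eq_sym (negbTE mn).
exact: gdual0.
Qed.

Lemma gdual_kos n b phi x : homog n phi -> phi (kos b x) = (-1) ^+ (b && par n) * phi x.
Proof.
move=> hphi; have phiL : linear phi by exact: gdual_linear.
elim/gcomp_ind: x => [|x y ex ey|m x hx].
- by rewrite (lin0 (kos_linear _)) (lin0 phiL) mulr0.
- by rewrite (linD _ _ (kos_linear _)) !(linD _ _ phiL) ex ey mulrDr.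
rewrite (kosE _ hx) (linZ _ _ phiL).
have [->|mn] := eqVneq m (- n); first by rewrite parN.
by rewrite (gdual_homog0 hphi hx mn) mulr0 scaler0.
Qed.

(** [evaluate] stripped of its Koszul signs, which on homogeneous functionals amount to one global
    sign. *)
Fixpoint prod_eval Phi s : K^o :=
  match Phi, s with
  | [::], [::] => 1
  | phi :: Phi', x :: s' => phi x *: prod_eval Phi' s'
  | _, _ => 0
  end.

Lemma prod_eval_multilinear Phi : multilinear (prod_eval Phi).
Proof.
move=> u; elim: u Phi => [|c u IH] [|phi Phi] v a x y /=; rewrite ?scaler0 ?addr0 //.
  by rewrite gdual_linear scalerDl scalerA.
by rewrite IH scalerDr !scalerA [_ * a]mulrC.
Qed.

Lemma prod_eval_cat Phi Psi s :
  prod_eval (Phi ++ Psi) s =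
  prod_eval Phi (take (size Phi) s) * prod_eval Psi (drop (size Phi) s).
Proof.
elim: Phi s => [|phi Phi IH] [|x s] /=; rewrite ?mul1r ?mul0r //.
by rewrite IH -!scalerAl.
Qed.

Lemma prod_eval_deg ds es Phi s : homogs ds Phi -> homogs es s ->
  \sum_(e <- es) e != - \sum_(d <- ds) d -> prod_eval Phi s = 0.
Proof.
elim: ds es Phi s => [|d ds IH] [|e es] [|phi Phi] [|x s] //=.
  by rewrite !big_nil oppr0 eqxx.
move=> /andP[hphi hPhi] /andP[hx hs]; rewrite !big_cons => ne.
have [ed|/(gdual_homog0 hphi hx)->] := eqVneq e (- d); last by rewrite scale0r.
by rewrite (IH es) ?scaler0 //; apply: contra ne => /eqP->; rewrite ed opprD.
Qed.

Lemma prod_eval_kosl ds b Phi s : homogs ds Phi ->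
  prod_eval (map (kos b) Phi) s = (-1) ^+ (b && par (\sum_(d <- ds) d)) * prod_eval Phi s.
Proof.
elim: ds Phi s => [|d ds IH] [|phi Phi] [|x s] //=; rewrite ?mulr0 //.
  by rewrite big_nil andbF mul1r.
move=> /andP[hphi hPhi]; rewrite (IH _ _ hPhi) (kosE _ hphi) gdualZ big_cons parD.
rewrite -[_ *: _]/(_ * _) -[_ *: _]/(_ * _) mulrACA -signr_addb.
by case: (b) (par d) (par _) => [] [] [].
Qed.

Lemma prod_eval_kosr ds b Phi s : homogs ds Phi ->
  prod_eval Phi (map (kos b) s) = (-1) ^+ (b && par (\sum_(d <- ds) d)) * prod_eval Phi s.
Proof.
elim: ds Phi s => [|d ds IH] [|phi Phi] [|x s] //=; rewrite ?mulr0 //.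
  by rewrite big_nil andbF mul1r.
move=> /andP[hphi hPhi]; rewrite (IH _ _ hPhi) (gdual_kos _ _ hphi) big_cons parD.
rewrite -[_ *: _]/(_ * _) -[_ *: _]/(_ * _) mulrACA -signr_addb.
by case: (b) (par d) (par _) => [] [] [].
Qed.

(** The parity of the sum of the products d_i d_j over i < j. *)
Fixpoint pairs (ds : seq int) : bool :=
  if ds is d :: ds' then (par d && par (\sum_(e <- ds') e)) (+) pairs ds' else false.

Lemma pairs_cat ds es : pairs (ds ++ es) =
  pairs ds (+) pairs es (+) (par (\sum_(d <- ds) d) && par (\sum_(e <- es) e)).
Proof.
elim: ds => [|d ds IH] /=; first by rewrite big_nil addbF.
rewrite IH big_cons big_cat /= !parD.
move: (par d) (par (\sum_(e <- ds) e)) (par (\sum_(e <- es) e)) (pairs ds) (pairs es).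
by do 5!case.
Qed.

Lemma evaluate_linear_head phi Phi s :
  linear (fun x => evaluate (phi :: Phi) (x :: s)).
Proof. by move=> a x y; apply: gsum_linear => n b z t; rewrite gdual_linear scalerDl scalerA. Qed.

Lemma evaluate_homog_head n phi Phi x s : homog n x ->
  evaluate (phi :: Phi) (x :: s) = phi x *: evaluate (map (koszul n) Phi) s.
Proof.
move=> hx /=; rewrite (gsum_homog _ hx) // => m b z t.
by rewrite gdual_linear scalerDl scalerA.
Qed.

(** A homogeneous functional phi_i only sees the component of degree -|phi_i|, so the
    Koszul sign does not depend on [s]. *)
Lemma evaluate_homog ds Phi s : homogs ds Phi ->
  evaluate Phi s = (-1) ^+ pairs ds * prod_eval Phi s.
Proof.
elim: s ds Phi => [|x s IH] [|d ds] [|phi Phi] //=; rewrite ?mulr0 ?mul1r //.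
move=> /andP[hphi hPhi]; have eL := evaluate_linear_head phi Phi s.
have phiL : linear phi by exact: gdual_linear.
rewrite -/(evaluate (phi :: Phi) (x :: s)).
elim/gcomp_ind: x => [|x y ex ey|m x hx].
- by rewrite (lin0 eL) (lin0 phiL) scale0r mulr0.
- by rewrite (linD _ _ eL) (linD _ _ phiL) ex ey scalerDl mulrDr.
rewrite (evaluate_homog_head _ _ _ hx).
have [em|/(gdual_homog0 hphi hx)->] := eqVneq m (- d); last by rewrite !scale0r mulr0.
rewrite (IH ds); last exact: homogs_koszul.
rewrite (eq_map (koszul_kos _)) (prod_eval_kosl _ _ hPhi) em parN.
have mulrA4 (a b c e : K) : a * (b * (c * e)) = b * c * (a * e).
  by rewrite mulrCA -!mulrA [a * (_ * _)]mulrCA.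
by rewrite addbC signr_addb; exact: mulrA4.
Qed.

(** This is linearity in the functionals, not in the vectors. For a homogeneous first vector the
    Koszul sign acts linearly on the later functionals, to which the induction applies. *)
Lemma evaluate_multilineal s : multilinear (fun Phi => evaluate Phi s).
Proof.
elim: s => [|c s IH] u v a x y; first by case: u => [|? ?] /=; rewrite scaler0 addr0.
elim/gcomp_ind: c => [|c c' ec ec'|n c hc].
- by case: u => [|? ?]; rewrite !(lin0 (evaluate_linear_head _ _ _)) scaler0 addr0.
- case: u ec ec' => [|? ?] ec ec'; rewrite !(linD _ _ (evaluate_linear_head _ _ _)) ec ec';
  by rewrite scalerDr -!addrA; congr (_ + _); rewrite addrCA.
case: u => [|psi u]; rewrite !(evaluate_homog_head _ _ _ hc).
  by rewrite -[LHS]/((a * x c + y c) *: evaluate _ s) scalerDl -scalerA.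
rewrite !map_cat /= koszul_linear IH scalerDr !scalerA.
by rewrite [a * _]mulrC.
Qed.
End HomogeneousFunctionals.

(** * The operations of the graded dual *)

Section DualOperations.
Variables (K : fieldType) (C : ainf_coalg K).
Implicit Types (Phi Psi U V : seq (gdual C)) (x c : C).

Let w := @coalg_op K C.

Lemma coalg_op_linear k : linear (w k).
Proof. by case: (coalg_axiom C). Qed.

(** w_k takes values in the k-th tensor power, so only words of length k matter. *)
Lemma eq_tlift_coalg_op (W : lmodType K) (f g : seq C -> W) k x :
  multilinear f -> multilinear g -> (0 < k)%N -> (forall s, size s = k -> f s = g s) ->
  tlift f (w k x) = tlift g (w k x).
Proof.
move=> fL gL k0 fg; have wL := coalg_op_linear k.
elim/gcomp_ind: x => [|x y ex ey|n x hx].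
- by rewrite (lin0 wL) !(lin0 (tlift_linear _)).
- by rewrite (linD _ _ wL) !(linD _ _ (tlift_linear _)) // ex ey.
have [_ _ wdeg _ _] := coalg_axiom C.
rewrite ?/w ?/wM; elim: (wdeg k n x k0 hx) => [|a r v [ds [s [-> sk _ _]]] _ IH].
  by rewrite !(lin0 (tlift_linear _)).
by rewrite !(tlift_linear fL, tlift_linear gL) IH !tlift_pure // fg.
Qed.

(** The first two parities make up k(|phi_1| + ... + |phi_k| + 1) from the definition of m_k;
    [pairs ds] comes from the evaluation. *)
Lemma dual_op_homogE ds Phi x : homogs ds Phi ->
  dual_op Phi x = (-1) ^+ (odd (size Phi) (+) (odd (size Phi) && par (\sum_(d <- ds) d))
    (+) pairs ds) * tlift (prod_eval Phi) (w (size Phi) x).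
Proof.
move=> hPhi; rewrite /= /dual_op_fun -/w.
set Psi := map _ Phi.
have -> : tlift (evaluate Psi) (w (size Phi) x) =
    (-1) ^+ ((odd (size Phi) && par (\sum_(d <- ds) d)) (+) pairs ds)
      *: tlift (prod_eval Phi) (w (size Phi) x).
  have eL := evaluate_multilinear Psi; have pL := @prod_eval_multilinear _ _ Phi.
  elim/tens_ind: (w _ x) => [|a s t IH].
    by rewrite !(lin0 (tlift_linear _)) // scaler0.
  rewrite (tlift_linear eL) (tlift_linear pL) IH !tlift_pure // scalerDr; congr (_ + _).
  rewrite (evaluate_homog _ (homogs_koszul _ hPhi)) (eq_map (koszul_kos _)).
  rewrite (prod_eval_kosl _ _ hPhi) par_nat mulrA -signr_addb addbC.
  exact: (@mulrCA K).
by rewrite scalerA -[X in X * _]signr_odd -signr_addb addbA.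
Qed.

Lemma dual_op_multilinear : multilinear (@dual_op K C).
Proof.
move=> u v a phi psi; apply: gdual_ext => x.
rewrite -[RHS]/(a * dual_op (u ++ phi :: v) x + dual_op (u ++ psi :: v) x).
rewrite /= /dual_op_fun !size_cat /= -/w.
set k := (_ + _)%N; set t := w k x.
pose E Psi := tlift (evaluate (map (koszul k%:Z) Psi)) t.
rewrite -/(E _) -/(E (u ++ phi :: v)) -/(E (u ++ psi :: v)).
suff EL : multilinear E.
  by rewrite EL scalerDr; congr (_ + _); exact: (@mulrCA K).
move=> u1 v1 b phi1 psi1; rewrite /E !map_cat /= koszul_linear.
apply: (tlift_param (f := fun z => evaluate (map (koszul k%:Z) u1 ++ z :: map (koszul k%:Z) v1))).
- by move=> s; exact: evaluate_multilineal.
- by move=> z; exact: evaluate_multilinear.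
Qed.

(** On an element of degree m, w_k yields words of degree m + 2 - k; the functionals vanish on these
    unless that degree is minus the sum of their own. *)
Lemma dual_op_deg : deg_words (fun k => 2 - k%:Z) (@dual_op K C).
Proof.
move=> ds Phi hPhi; set n := _ + _; apply/gdual_homogP => x.
have DL : linear (dual_op Phi) by exact: gdual_linear.
elim/gcomp_ind: x => [|x y ex ey|m x hx].
- by rewrite (lin0 (gcomp_linear _)).
- by rewrite (linD _ _ (gcomp_linear _)) !(linD _ _ DL) ex ey.
rewrite -(eqP hx) gcompK; case: eqP => [//|/eqP mn]; rewrite (lin0 DL) (eqP hx).
rewrite (dual_op_homogE _ hPhi).
have [w0 _ wdeg _ _] := coalg_axiom C.
have pL := @prod_eval_multilinear _ _ Phi.
(* The degree condition on w_k concerns positive k only; w_0 is zero. *)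
have [k0|k0] := posnP (size Phi).
  by rewrite k0 [w _ _]w0 (lin0 (tlift_linear _)) ?mulr0.
rewrite ?/w ?/wM; elim: (wdeg _ m x k0 hx) => [|a r t [es [s [-> sk hs es_sum]]] _ IH].
  by rewrite (lin0 (tlift_linear _)) ?mulr0.
rewrite (tlift_linear pL) tlift_pure // mulrDr -IH addr0.
rewrite (prod_eval_deg hPhi hs) ?scaler0 ?mulr0 //.
apply: contra mn => /eqP e; rewrite -es_sum in e.
apply/eqP; rewrite /n; lia.
Qed.
End DualOperations.

(** * The action of the graded dual on a comodule *)

Section DualAction.
Variables (K : fieldType) (C : ainf_coalg K) (M : rcomodule C).
Implicit Types (Phi Psi U V : seq (gdual C)) (x z : M) (b : bool).

Let w := @coalg_op K C.
Let wM := @rcomodule_coact K C M.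
Let act := dual_act wM.

Lemma coact_linear k : linear (wM k).
Proof. by case: (rcomodule_axiom M). Qed.

Lemma eq_plift_coact (W : lmodType K) (f g : M -> seq C -> W) k x :
  pmultilinear f -> pmultilinear g ->
  (forall z s, size s = k -> f z s = g z s) ->
  plift f (wM k.+1 x) = plift g (wM k.+1 x).
Proof.
move=> fL gL fg; have wL := coact_linear k.+1.
elim/gcomp_ind: x => [|x y ex ey|n x hx].
- by rewrite (lin0 wL) !(lin0 (plift_linear _)).
- by rewrite (linD _ _ wL) !(linD _ _ (plift_linear _)) // ex ey.
have [_ _ wdeg _] := rcomodule_axiom M.
rewrite ?/w ?/wM; elim: (wdeg k.+1 n x isT hx) => [|a r v [e [ds [z [s [-> _ [sk _ _]]]]]] _ IH].
  by rewrite !(lin0 (plift_linear _)).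
by rewrite !(plift_linear fL, plift_linear gL) IH !plift_pure // fg.
Qed.

Definition act_eval Phi z s : M :=
  gsum (fun n y => (evaluate (map (koszul n) Phi) s : K) *: y) z.

Lemma act_eval_linear Phi s : linear (act_eval Phi ^~ s).
Proof. by apply: gsum_linear => n; exact: scale_linear. Qed.

Lemma act_evalE Phi n z s : homog n z ->
  act_eval Phi z s = (evaluate (map (koszul n) Phi) s : K) *: z.
Proof.
by move=> hz; rewrite /act_eval (gsum_homog _ hz) // => m; exact: scale_linear.
Qed.

Lemma act_eval_pmultilinear Phi : pmultilinear (act_eval Phi).
Proof.
split=> [|z u v a x y]; first exact: act_eval_linear.
have L := act_eval_linear Phi.
elim/gcomp_ind: z => [|z z' ez ez'|n z hz].
- by rewrite !(lin0 (L _)) scaler0 addr0.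
- rewrite !(linD _ _ (L _)) ez ez' scalerDr -!addrA; congr (_ + _).
  by rewrite addrCA.
by rewrite !(act_evalE _ _ hz) evaluate_multilinear scalerDl scalerA.
Qed.

Lemma act_eval_multilineal z s : multilinear (fun Phi => act_eval Phi z s).
Proof.
move=> u v a phi psi; have L Phi := act_eval_linear Phi s.
elim/gcomp_ind: z => [|z z' ez ez'|n z hz].
- by rewrite !(lin0 (L _)) scaler0 addr0.
- rewrite !(linD _ _ (L _)) ez ez' scalerDr -!addrA; congr (_ + _).
  by rewrite addrCA.
rewrite !(act_evalE _ _ hz) !map_cat /= koszul_linear evaluate_multilineal.
by rewrite scalerDl scalerA.
Qed.

Lemma dual_act_multilinear x : multilinear (act^~ x).
Proof.
move=> u v a phi psi; rewrite /act /dual_act !size_cat /=.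
set k := (_ + _).+1; rewrite !map_cat /= koszul_linear.
apply: (plift_param (f := fun y => act_eval
  (map (koszul (2 - k%:Z)) u ++ y :: map (koszul (2 - k%:Z)) v))).
- by move=> z s; exact: act_eval_multilineal.
- by move=> y; exact: act_eval_pmultilinear.
Qed.

Lemma dual_act_linear Phi : linear (act Phi).
Proof.
move=> a x y; rewrite /act /dual_act coact_linear plift_linear //.
exact: act_eval_pmultilinear.
Qed.

(** The sign of moving the functionals past [z] is kept as the map [kos b], so [z] need not be
    homogeneous. *)
Definition prod_act Phi b z s : M := (prod_eval Phi s : K) *: kos b z.

Lemma prod_act_pmultilinear Phi b : pmultilinear (prod_act Phi b).
Proof.
rewrite /prod_act; split=> [s|z u v a x y].
  by apply: scale_linear; exact: kos_linear.
by rewrite prod_eval_multilinear scalerDl scalerA.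
Qed.

(** The first parity is that of moving w^M_k, of degree 2 - k with k = [(size Phi).+1], past the
    functionals; [pairs ds] comes from evaluating them, and [N] inside [prod_act] from moving them
    past M. *)
Lemma dual_act_homogE ds Phi x : homogs ds Phi ->
  let N := par (\sum_(d <- ds) d) in
  act Phi x = (-1) ^+ ((~~ odd (size Phi) && N) (+) pairs ds) *:
    plift (prod_act Phi N) (wM (size Phi).+1 x).
Proof.
move=> hPhi N; rewrite /act /dual_act; set k := (size Phi).+1.
set Psi := map _ Phi; have aL := act_eval_pmultilinear Psi.
have pL := prod_act_pmultilinear Phi N.
have hPsi : homogs ds Psi by exact: homogs_koszul.
rewrite -/(act_eval Psi); elim/ptens_ind: (wM _ _) => [|a z s t IH].
  by rewrite !(lin0 (plift_linear _)) // scaler0.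
rewrite (plift_linear aL) (plift_linear pL) IH !plift_pure // scalerDr; congr (_ + _).
rewrite scalerA [_ * a]mulrC -scalerA; congr (_ *: _) => {IH}.
have L := act_eval_linear Psi; have L' := prod_act_pmultilinear Phi N.
elim/gcomp_ind: z => [|z z' ez ez'|n z hz].
- by rewrite !(lin0 (L _)) (lin0 (L'.1 s)) scaler0.
- by rewrite !(linD _ _ (L _)) (linD _ _ (L'.1 s)) ez ez' scalerDr.
rewrite (act_evalE _ _ hz) (evaluate_homog _ (homogs_koszul n hPsi)).
rewrite (eq_map (koszul_kos _)) (prod_eval_kosl _ _ hPsi).
rewrite /Psi (eq_map (koszul_kos _)) (prod_eval_kosl _ _ hPhi) -/N.
rewrite /prod_act (kosE _ hz) !scalerA mulrA mulrA -!signr_addb.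
rewrite mulrAC -signr_addb; congr (_ ^+ _ * _ *: _).
rewrite parD parN par_nat /=.
by case: (N) (pairs ds) (par n) (odd _) => [] [] [] [].
Qed.

Lemma dual_act_deg ds Phi d x : homogs ds Phi -> homog d x ->
  homog (\sum_(e <- ds) e + d + (2 - (size Phi).+1%:Z)) (act Phi x).
Proof.
move=> hPhi hx; rewrite (dual_act_homogE _ hPhi); apply: homogZ.
set N := par _; have pL := prod_act_pmultilinear Phi N.
have [_ _ wdeg _] := rcomodule_axiom M.
rewrite ?/w ?/wM; elim: (wdeg (size Phi).+1 d x isT hx)
  => [|a r v [e [es [z [s [-> hz [sk hs es_sum]]]]]] _ IH].
  by rewrite (lin0 (plift_linear _)) // homog0.
rewrite (plift_linear pL) plift_pure // /homog gcomp_linear (eqP IH) eq_sym.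
rewrite /prod_act; have [e1|/(prod_eval_deg hPhi hs)->] :=
    eqVneq (\sum_(e <- es) e) (- \sum_(d <- ds) d); last first.
  by rewrite scale0r (lin0 (gcomp_linear _)).
rewrite (kosE _ hz) !(linZ _ _ (gcomp_linear _)).
suff -> : \sum_(e <- ds) e + d + (2 - (size Phi).+1%:Z) = e by rewrite (eqP hz).
by rewrite e1 in es_sum; lia.
Qed.

Lemma dual_act_kos ds Phi b x : homogs ds Phi ->
  kos b (act Phi x) =
  (-1) ^+ (b && (par (\sum_(d <- ds) d) (+) ~~ odd (size Phi))) *: act Phi (kos b x).
Proof.
move=> hPhi; have L := dual_act_linear Phi.
elim/gcomp_ind: x => [|x y ex ey|n x hx].
- by rewrite (lin0 (kos_linear _)) (lin0 L) (lin0 (kos_linear _)) scaler0.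
- rewrite (linD _ _ (kos_linear _)) !(linD _ _ L) (linD _ _ (kos_linear _)) ex ey.
  by rewrite scalerDr.
rewrite (kosE _ (dual_act_deg hPhi hx)) (kosE _ hx) (linZ _ _ L) scalerA -signr_addb.
congr (_ ^+ _ *: _); rewrite !parD parN par_nat /=.
by case: b (par _) (par _) (odd _) => [] [] [] [].
Qed.
End DualAction.

Section ShiftedSums.
Variable W : zmodType.

(** The comodule factor stands on the left, so here the first index is the positive one and gets
    shifted. *)
Lemma sum_triples_pos1 (n : nat) (P : pred nat) (G : nat -> nat -> nat -> W) :
  \sum_(p < n.+2) \sum_(q < n.+2)
    \sum_(r < n.+2 | [&& (p + q + r == n.+1)%N, (0 < p)%N & P q]) G p q r =
  \sum_(p < n.+1) \sum_(q < (n - p).+1 | P q) G p.+1 q (n - p - q)%N.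
Proof.
rewrite big_ord_recl [X in X + _]big1 ?add0r; last first.
  by move=> q _; rewrite big_pred0 // => r; rewrite andbF.
pose Q p := \sum_(q < n.+2) \sum_(r < n.+2 | [&& (p + q + r == n.+1)%N, P q & predT (nat_of_ord r)])
   G p q r.
transitivity (\sum_(p < n.+1) Q p.+1).
  apply: eq_bigr => p _; apply: eq_bigr => q _; apply: eq_bigl => r.
  by rewrite /bump /= andbT.
transitivity (\sum_(p < n.+2) (if p == 0%N :> nat then 0 else Q p)).
  by rewrite [RHS]big_ord_recl eqxx add0r.
have := sum_triples n.+1 P predT (fun p q r => if p == 0%N then 0 else G p q r).
rewrite [RHS]big_ord_recl [X in _ = X + _]big1 // add0r => e.
transitivity (\sum_(p < n.+1)
   \sum_(q < (n.+1 - (lift ord0 p : 'I_n.+2)).+1 | P q && true) G p.+1 q (n.+1 - p.+1 - q)%N).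
  rewrite -[RHS]e; apply: eq_bigr => p _; case: eqP => // _.
  by rewrite big1 // => q _; rewrite big1.
by apply: eq_bigr => p _; rewrite /= /bump /= subSS; apply: eq_bigl => q; rewrite andbT.
Qed.

Lemma sum_pairs_pos1 (n : nat) (G : nat -> nat -> W) :
  \sum_(b < n.+2) \sum_(c < n.+2 | (b + c == n.+1)%N && (0 < b)%N) G b c =
  \sum_(a < n.+1) G a.+1 (n - a)%N.
Proof.
rewrite big_ord_recl [X in X + _]big_pred0 ?add0r; last by move=> c; rewrite andbF.
apply: eq_bigr => a _; have an := ltn_ord a.
have lt : (n - a < n.+2)%N by lia.
rewrite (big_pred1 (Ordinal lt)) // => c /=; rewrite /bump /= andbT.
apply/eqP/eqP => [e|->]; last by rewrite /=; lia.
by apply: val_inj => /=; lia.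
Qed.
End ShiftedSums.

(** * Contraction of the comodule structure with homogeneous functionals *)

Section DualModule.
Variables (K : fieldType) (C : ainf_coalg K) (M : rcomodule C).
Implicit Types (Phi Psi U V X : seq (gdual C)) (x z : M) (b : bool).

Local Notation w := (@coalg_op K C).
Local Notation wM := (@rcomodule_coact K C M).
Local Notation act := (dual_act wM).
Let L Phi b := plift (@prod_act K C M Phi b).

Lemma L_linear Phi b : linear (L Phi b).
Proof. by apply: plift_linear; exact: prod_act_pmultilinear. Qed.

Lemma idP_w_id_pmultilinear p q : pmultilinear (fun (z : M) s => tlift (fun s' =>
    ppure (koszul (2 - q%:Z) z)
      (map (koszul (2 - q%:Z)) (take p s) ++ s' ++ drop p.+1 s))
    (w q (nth 0 s p))).
Proof.
have [pL1 pL2] := ppure_pmultilinear M C.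
have kL := koszul_linear (2 - q%:Z).
split=> [s|z].
  apply: (tlift_param (f := fun z s' => ppure (koszul (2 - q%:Z) z)
      (map (koszul (2 - q%:Z)) (take p s) ++ s' ++ drop p.+1 s))).
    by move=> s' a x y; rewrite kL pL1.
  by move=> z; exact: ppure_infix_multilinear.
(* Through [head] and [behead] the map becomes a function of [take p s] and [drop p s], so that
   linearity can be checked on each side of the cut. *)
pose g (U T : seq C) := tlift (fun s' => ppure (koszul (2 - q%:Z) z)
  (map (koszul (2 - q%:Z)) U ++ s' ++ behead T)) (w q (head 0 T)).
have gL (U T : seq C) :=
  ppure_infix_multilinear (koszul (2 - q%:Z) z) (map (koszul (2 - q%:Z)) U) T.
suff gM : multilinear (fun s => g (take p s) (drop p s)).
  move=> u v a x y; have := gM u v a x y; rewrite /g.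
  have e (s : seq C) : behead (drop p s) = drop p.+1 s by rewrite -drop1 drop_drop add1n.
  by rewrite !e -!nth0 !nth_drop !addn0.
apply: multilinear_take_drop => [T u v a x y|U u v a x y]; rewrite /g.
  have H := (@tlift_param K C (ptens M C) C (fun c s' => ppure (koszul (2 - q%:Z) z)
    (map (koszul (2 - q%:Z)) (u ++ c :: v) ++ s' ++ behead T))) (w q (head 0 T)).
  apply: H => [s' b x1 y1|x1].
    by rewrite !map_cat /= kL -!catA /= pL2.
  exact: gL.
case: u => [|c u] /=.
  by rewrite (coalg_op_linear (C := C)) (tlift_linear (gL _ _)).
have H := @tlift_param K C (ptens M C) C (fun c s' => ppure (koszul (2 - q%:Z) z)
  (map (koszul (2 - q%:Z)) U ++ s' ++ u ++ c :: v)) (w q c).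
apply: H => [s' b x1 y1|x1]; first by rewrite !catA pL2.
exact: gL.
Qed.

(** The sign has two sources: w_q, of the parity of q, passes the letters paired with [U], and m_q
    on [V] carries the sign of [dual_op_homogE]. The sign of passing the comodule factor appears as
    the change from [N] to [N (+) odd q]. *)
Lemma L_idP_w_id du dv dw U V X t :
  homogs du U -> homogs dv V -> homogs dw X -> (0 < size V)%N ->
  let q := size V in let N := par (\sum_(d <- du ++ dv ++ dw) d) in
  L (U ++ dual_op V :: X) (N (+) odd q) t =
  (-1) ^+ ((odd q && par (\sum_(d <- du) d))
     (+) (odd q (+) (odd q && par (\sum_(d <- dv) d)) (+) pairs dv)) *:
  L (U ++ V ++ X) N (idP_w_id (size U).+1 q t).
Proof.
move=> hU hV hX V0 q N.
have iL := idP_w_id_pmultilinear (size U) q.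
have LL := L_linear (U ++ V ++ X) N; have LL' := L_linear (U ++ dual_op V :: X) (N (+) odd q).
have IL : linear (@idP_w_id K C M (size U).+1 q) by exact: plift_linear.
set sg := (-1) ^+ _; elim/ptens_ind: t => [|a z s t IH].
  by rewrite (lin0 IL) (lin0 LL) (lin0 LL') scaler0.
rewrite LL' IL LL IH scalerDr !scalerA [sg * a]mulrC -!scalerA; congr (_ *: _ + _) => {IH t a}.
rewrite {1}/L /idP_w_id !plift_pure //; last exact: prod_act_pmultilinear.
rewrite /= (tlift_comp (w q _) LL); last first.
  exact: ppure_infix_multilinear.
rewrite /prod_act prod_eval_cat; set c := nth 0 s (size U).
(* If [s] is too short to have a letter for w_q, both sides vanish: the default letter is 0, and
   nonempty lists of functionals evaluate to 0 on the empty word. *)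
have [lts|les] := ltnP (size U) (size s); last first.
  rewrite drop_oversize // mulr0 scale0r /c nth_default //.
  rewrite (lin0 (coalg_op_linear q)) (lin0 (tlift_linear _)) ?scaler0 //.
  by apply: multilinear_comp => //; exact: ppure_infix_multilinear.
have sU : size (take (size U) s) = size U by rewrite size_takel // ltnW.
rewrite (drop_nth 0 lts) -/c; set D := drop _ s.
pose Y := (prod_eval U (take (size U) s) * prod_eval X D : K) *: kos (N (+) odd q) z.
transitivity ((dual_op V c : K) *: Y).
  by rewrite /= scalerA; congr (_ *: _); rewrite mulrCA.
rewrite (dual_op_homogE _ hV) -/q.
transitivity (sg *: ((-1) ^+ (odd q && par (\sum_(d <- du) d)) *:
   ((tlift (prod_eval V) (w q c) : K) *: Y))).
  rewrite !scalerA; congr (_ *: _).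
  rewrite [sg * _](_ : _ = (-1) ^+ (odd q (+) (odd q && par (\sum_(d <- dv) d)) (+) pairs dv)) //.
  by rewrite /sg -signr_addb addbC addKb.
congr (_ *: _).
have hL : linear (fun e : K^o => (-1) ^+ (odd q && par (\sum_(d <- du) d)) *: (e *: Y)).
  move=> a x y; rewrite scalerDl scalerDr -!scalerA; congr (_ + _).
  by rewrite !scalerA; congr (_ * _ *: _); exact: (etrans (@mulrCA K _ _ _) (@mulrA K _ _ _)).
rewrite (tlift_comp _ hL (@prod_eval_multilinear _ _ V)).
apply: eq_tlift_coalg_op => // [||s' ss'].
- exact: multilinear_comp hL (@prod_eval_multilinear _ _ V).
- by apply: multilinear_comp => //; exact: ppure_infix_multilinear.
rewrite /L plift_pure; last exact: prod_act_pmultilinear.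
rewrite /prod_act prod_eval_cat take_size_cat ?drop_size_cat ?size_map //.
rewrite prod_eval_cat take_size_cat ?drop_size_cat //.
rewrite (eq_map (koszul_kos _)) (prod_eval_kosr _ _ hU) koszul_kos kos_comp.
rewrite parD parN par_nat /= /Y !scalerA; congr (_ *: _).
rewrite -!mulrA; congr (_ * _); rewrite mulrCA; congr (_ * _).
Qed.

Lemma wP_id_pmultilinear k : pmultilinear (fun (z : M) s =>
  plift (fun (y : M) (s' : seq C) => ppure y (s' ++ s)) (wM k z)).
Proof.
have [pL1 pL2] := ppure_pmultilinear M C.
have sL (s : seq C) : pmultilinear (fun (y : M) (s' : seq C) => ppure y (s' ++ s)).
  by split=> [s'|y]; [exact: pL1 | exact: multilinear_suffix].
split=> [s a x y|z u v a x y].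
  by rewrite coact_linear (plift_linear (sL s)).
apply: (plift_param (f := fun (c : C) y s' => ppure y (s' ++ u ++ c :: v))) => [y' s' c x1 y1|x1].
  by rewrite !catA pL2.
exact: sL.
Qed.

(** The first two parities convert the unsigned contraction with [U] into the action; the last one
    is the sign of moving [kos Nv] through [act U]. *)
Lemma L_wP_id du dv U V t :
  homogs du U -> homogs dv V ->
  let Nu := par (\sum_(d <- du) d) in let Nv := par (\sum_(d <- dv) d) in
  L (U ++ V) (Nu (+) Nv) (wP_id wM (size U).+1 t) =
  (-1) ^+ ((~~ odd (size U) && Nu) (+) pairs du (+) (Nv && (Nu (+) ~~ odd (size U)))) *:
  act U (L V Nv t).
Proof.
move=> hU hV Nu Nv.
have iL := wP_id_pmultilinear (size U).+1.
have LL := L_linear (U ++ V) (Nu (+) Nv); have LL' := L_linear V Nv.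
have AL := @dual_act_linear K C M U.
have IL : linear (wP_id wM (size U).+1) by exact: plift_linear.
set sg := (-1) ^+ _; elim/ptens_ind: t => [|a z s t IH].
  by rewrite (lin0 IL) (lin0 LL) (lin0 LL') (lin0 AL) scaler0.
rewrite LL' IL LL AL IH scalerDr !scalerA [sg * a]mulrC -!scalerA; congr (_ *: _ + _) => {IH t a}.
rewrite {2}/L /wP_id !plift_pure //; last exact: prod_act_pmultilinear.
have [pL1 pL2] := ppure_pmultilinear M C.
have sL : pmultilinear (fun (y : M) (s' : seq C) => ppure y (s' ++ s)).
  by split=> [s'|y]; [exact: pL1 | exact: multilinear_suffix].
rewrite (plift_comp _ LL sL).
have hL : linear (fun y : M => (prod_eval V s : K) *: kos Nv y).
  by apply: scale_linear; exact: kos_linear.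
have pL := prod_act_pmultilinear M U Nu.
transitivity ((prod_eval V s : K) *: kos Nv (L U Nu (wM (size U).+1 z))).
  rewrite (plift_comp _ hL pL); apply: eq_plift_coact.
  - by split=> [s' a x y|y]; [rewrite pL1 LL | exact: multilinear_comp LL (sL.2 y)].
  - by split=> [s' a x y|y]; [rewrite pL.1 hL | exact: multilinear_comp hL (pL.2 y)].
  move=> y s' ss'; rewrite /L plift_pure; last exact: prod_act_pmultilinear.
  rewrite /prod_act prod_eval_cat take_size_cat ?drop_size_cat //.
  by rewrite (linZ _ _ (kos_linear _)) kos_comp scalerA [Nu (+) _]addbC mulrC.
have -> : L U Nu (wM (size U).+1 z) = (-1) ^+ ((~~ odd (size U) && Nu) (+) pairs du) *: act U z.
  by rewrite (dual_act_homogE _ hU) scalerA -signr_addb addbb expr0 scale1r.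
rewrite (linZ _ _ (kos_linear _)) (dual_act_kos _ _ hU) /prod_act (linZ _ _ AL).
rewrite !scalerA; congr (_ *: _).
by rewrite /sg [in RHS]signr_addb; exact: (etrans (esym (@mulrA K _ _ _)) (@mulrC K _ _)).
Qed.

Lemma L_kos du b c U Y t : homogs du U ->
  L (map (kos b) U ++ Y) c t = (-1) ^+ (b && par (\sum_(d <- du) d)) *: L (U ++ Y) c t.
Proof.
move=> hU; rewrite /L.
have pL Phi := prod_act_pmultilinear M Phi c.
set sg := (-1) ^+ _.
have hL : linear (fun y : M => sg *: y).
  by move=> e y z; rewrite scalerDr !scalerA mulrC.
transitivity (plift (fun z s => sg *: prod_act (U ++ Y) c z s) t); last first.
  by rewrite -(plift_comp t hL (pL _)).
apply: eq_plift => //.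
  split=> [s|z]; first exact: scale_linear _ ((pL _).1 s).
  exact: multilinear_comp hL ((pL _).2 z).
move=> z s; rewrite /prod_act !prod_eval_cat size_map (prod_eval_kosl _ _ hU).
by rewrite !scalerA -mulrA.
Qed.

(** The term (p, q, r + 1) of the module equation corresponds to the term (p + 1, q, r) of the
    comodule equation. The leading sign on the right depends on the whole word and not on the cuts,
    so it comes out of the sum. *)
Lemma dual_act_dual_op du dv dw U V X x :
  homogs du U -> homogs dv V -> homogs dw X -> (0 < size V)%N ->
  let ds := du ++ dv ++ dw in let N := par (\sum_(d <- ds) d) in
  let p := size U in let q := size V in let r := size X in
  let m := odd (p + q + r) in
  (-1) ^+ (p + q * r.+1) *: act (map (koszul (2 - q%:Z)) U ++ dual_op V :: X) x =
  (-1) ^+ (m (+) (m && N) (+) pairs ds) *: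
  L (U ++ V ++ X) N ((-1) ^+ (p.+1 * q + r) *: idP_w_id p.+1 q (wM (p.+1 + 1 + r) x)).
Proof.
move=> hU hV hX V0 ds N p q r m.
pose dm := \sum_(d <- dv) d + (2 - q%:Z).
have hm : homog dm (dual_op V) by exact: dual_op_deg.
have hword : homogs (du ++ dm :: dw) (map (koszul (2 - q%:Z)) U ++ dual_op V :: X).
  by apply: homogs_cat; [exact: homogs_koszul | rewrite /= hm].
rewrite (dual_act_homogE _ hword).
have -> : par (\sum_(d <- du ++ dm :: dw) d) = N (+) odd q.
  rewrite /N /ds !big_cat big_cons /= !parD parN !par_nat /=.
  by move: (par _) (par _) (par _) (odd q); do 4!case.
rewrite -/(L _ _ _) (eq_map (koszul_kos _)) (L_kos _ _ _ _ hU) (L_idP_w_id _ hU hV hX V0).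
rewrite -/q -/p -/N (linZ _ _ (L_linear _ _)) !scalerA.
have -> : (size (map (kos (par (2 - q%:Z))) U ++ dual_op V :: X)).+1 = (p.+1 + 1 + r)%N.
  by rewrite size_cat size_map /= /p /r; lia.
congr (_ *: _); rewrite -![(-1) ^+ (_ + _)]signr_odd -!signr_addb; congr (_ ^+ _).
rewrite size_cat size_map /ds !pairs_cat /= /dm /m /N /ds !big_cat /= !parD parN !par_nat.
rewrite !big_cons !parD parN !par_nat !oddD !oddM /= -/p -/q -/r ?oddD.
move: (par (\sum_(d <- du) d)) (par (\sum_(d <- dv) d)) (par (\sum_(d <- dw) d)).
move: (pairs du) (pairs dv) (pairs dw) (odd p) (odd q) (odd r).
by do 9!case.
Qed.

(** The term (a, b + 1) of the module equation corresponds to the term (a + 1, b) of the comodule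
    equation, with the same leading sign as in [dual_act_dual_op]. *)
Lemma dual_act_dual_act du dv U V x :
  homogs du U -> homogs dv V ->
  let ds := du ++ dv in let N := par (\sum_(d <- ds) d) in
  let a := size U in let b := size V in let m := odd (a + b) in
  (-1) ^+ a *: act (map (koszul (2 - b.+1%:Z)) U) (act V x) =
  (-1) ^+ (m (+) (m && N) (+) pairs ds) *:
  L (U ++ V) N ((-1) ^+ b *: wP_id wM a.+1 (wM b.+1 x)).
Proof.
move=> hU hV ds N a b m; rewrite (linZ _ _ (L_linear _ _)).
have -> : N = par (\sum_(d <- du) d) (+) par (\sum_(d <- dv) d).
  by rewrite /N /ds big_cat parD.
rewrite (L_wP_id _ hU hV) (dual_act_homogE _ hV) -/(L _ _ _).
rewrite (linZ _ _ (dual_act_linear _)) (dual_act_homogE _ (homogs_koszul _ hU)).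
rewrite (dual_act_homogE _ hU) -!/(L _ _ _) size_map.
rewrite -[X in L X _ _]cats0 (eq_map (koszul_kos _)) (L_kos _ _ _ _ hU) cats0.
rewrite !scalerA; congr (_ *: _); rewrite -[(-1) ^+ a]signr_odd -[(-1) ^+ b]signr_odd.
rewrite -!signr_addb; congr (_ ^+ _).
rewrite /ds pairs_cat /m oddD parD parN par_nat /= -/a -/b.
move: (par (\sum_(d <- du) d)) (par (\sum_(d <- dv) d)).
move: (pairs du) (pairs dv) (odd a) (odd b).
by do 6!case.
Qed.
End DualModule.


(** * The module equation over the graded dual *)

Section DualModuleEquation.
Variables (K : fieldType) (C : ainf_coalg K) (M : rcomodule C).

Local Notation wM := (@rcomodule_coact K C M).
Local Notation act := (dual_act wM).

Lemma dual_act_homog_eq ds s (x : M) : homogs ds s ->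
  lmodule_lhs (@dual_op K C) act s x = 0.
Proof.
move=> hs; set N := par (\sum_(d <- ds) d); set m := odd (size s).
have lin := @L_linear K C M s N.
(* With k functionals and one module element there are k + 1 inputs, so the comodule equation is
   taken at n = k + 1. *)
have := rcomodule_eq (rcomodule_axiom M) x (ltn0Sn (size s)).
rewrite (sum_triples_pos1 _ (leq 1) (fun p q r =>
  (-1) ^+ (p * q + r) *: @idP_w_id K C M p q (wM (p + 1 + r)%N x))).
rewrite (sum_pairs_pos1 _ (fun b c => (-1) ^+ c *: wP_id wM b (wM c.+1 x))).
move/(congr1 (fun t => (-1) ^+ (m (+) (m && N) (+) pairs ds) *: plift (prod_act s N) t)).
rewrite (lin0 lin) scaler0 => <-.
rewrite (linD _ _ lin) scalerDr /lmodule_lhs; cbv zeta; congr (_ + _).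
  rewrite (sum_triples_pos _ (leq 1) (fun p q r => (-1) ^+ (p + q * r) *:
    act (map (koszul (2 - q%:Z)) (take p s)
         ++ dual_op (take q (drop p s)) :: drop (p + q) s) x)).
  rewrite (lin_sum _ _ _ lin) scaler_sumr; apply: eq_bigr => p _.
  rewrite (lin_sum _ _ _ lin) scaler_sumr; apply: eq_bigr => q q0.
  have pn := ltn_ord p; have qn := ltn_ord q.
  have su : size (take p s) = p by rewrite size_takel.
  have sv : size (take q (drop p s)) = q by rewrite size_takel // size_drop.
  have sw : size (drop q (drop p s)) = (size s - p - q)%N by rewrite !size_drop.
  have := dual_act_dual_op x (homogs_take p hs) (homogs_take q (homogs_drop p hs))
    (homogs_drop q (homogs_drop p hs)).
  rewrite !cat_take_drop su sv sw => /(_ q0).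
  rewrite drop_drop [(q + p)%N]addnC => ->.
  by rewrite (_ : (p + q + (size s - p - q))%N = size s) //; lia.
rewrite (sum_pairs_pos _ (fun a b => (-1) ^+ a *:
  act (map (koszul (2 - b%:Z)) (take a s)) (act (drop a s) x))).
rewrite (lin_sum _ _ _ lin) scaler_sumr; apply: eq_bigr => a _.
have an := ltn_ord a.
have su : size (take a s) = a by rewrite size_takel.
have := dual_act_dual_act x (homogs_take a hs) (homogs_drop a hs).
rewrite !cat_take_drop su size_drop => ->.
by rewrite subnKC.
Qed.

Lemma lmodule_lhs_multilinear (V N : gradedType K) (m : seq V -> V)
    (op : seq V -> N -> N) x :
  multilinear m -> (forall y, multilinear (op^~ y)) -> (forall s, linear (op s)) ->
  multilinear (fun s => lmodule_lhs m op s x).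
Proof.
move=> mL opL op_linear u v a y z; rewrite /lmodule_lhs !size_cat /=.
set n := (_ + _).+1.
have pre (W : lmodType K) d t (g : seq V -> W) : multilinear g ->
    multilinear (fun s => g (map (koszul d) s ++ t)).
  by move=> gL; exact: multilinear_map (koszul_linear d) (multilinear_suffix _ gL).
(* The varied words all have the same length, so the index ranges can be frozen at [n] and the
   summands treated one by one. *)
pose F s := \sum_(p < n.+1) \sum_(q < n.+1)
    \sum_(r < n.+1 | [&& (p + q + r == n)%N, (0 < q)%N & (0 < r)%N])
    (-1) ^+ (p + q * r) *:
    op (map (koszul (2 - q%:Z)) (take p s)
         ++ m (take q (drop p s)) :: drop (p + q) s) x
  + \sum_(a < n.+1) \sum_(b < n.+1 | (a + b == n)%N && (0 < b)%N)
    (-1) ^+ a *: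
    op (map (koszul (2 - b%:Z)) (take a s)) (op (drop a s) x).
suff FL : multilinear F by exact: FL.
apply: multilinear_add; apply: multilinear_sum => p _; apply: multilinear_sum => q _.
  apply: multilinear_sum => r _; apply: multilinear_scale.
  pose g U T := op (map (koszul (2 - q%:Z)) U ++ m (take q T) :: drop q T) x.
  suff gL : multilinear (fun s => g (take p s) (drop p s)).
    by move=> u1 v1 b y1 z1; have := gL u1 v1 b y1 z1; rewrite /g !drop_drop [(q + p)%N]addnC.
  apply: multilinear_take_drop => [T|U]; first exact: (pre _ _ _ _ (opL x)).
  apply: (@multilinear_take_drop _ _ _ q (fun V1 V2 =>
    op (map (koszul (2 - q%:Z)) U ++ m V1 :: V2) x)) => [T|V1].
    move=> u1 v1 b y1 z1; rewrite mL; exact: (opL x).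
  exact: (multilinear_head (m V1) (multilinear_prefix _ (opL x))).
apply: multilinear_scale.
apply: (@multilinear_take_drop _ _ _ p (fun U T => op (map (koszul (2 - q%:Z)) U) (op T x))).
  by move=> T; exact: multilinear_map (koszul_linear _) (opL _).
by move=> U; exact: multilinear_comp (op_linear _) (opL x).
Qed.

Lemma dual_act_eq s (x : M) : lmodule_lhs (@dual_op K C) act s x = 0.
Proof.
move: s; apply: multilinear_homog_eq => [||ds s hs]; last exact: dual_act_homog_eq hs.
  apply: lmodule_lhs_multilinear.
  - exact: dual_op_multilinear.
  - exact: dual_act_multilinear.
  - exact: dual_act_linear.
by move=> u v a y z; rewrite scaler0 addr0.
Qed.
End DualModuleEquation.

(** * The functor *)
Section Functor.
Variables (K : fieldType) (C : ainf_coalg K) (A : ainf_alg K) (f : pairing C A).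

Lemma pairing_act_lmodule (M : rcomodule C) : is_lmodule (pairing_act f M).
Proof.
have fM := pairing_axiom f.
have [_ aL ad _] := alg_axiom A.
split.
- by move=> x; apply: (restrict_multilinear fM) => y; exact: dual_act_multilinear.
- by apply: restrict_linear; exact: dual_act_linear.
- by move=> ds s d x; apply: (restrict_deg fM); exact: dual_act_deg.
move=> s x; apply: (restrict_eq aL ad _ _ fM).
- exact: dual_op_multilinear.
- exact: dual_op_deg.
- exact: dual_act_multilinear.
- exact: dual_act_linear.
- exact: dual_act_eq.
Qed.

(** Since [g] preserves degrees, moving the functionals past [z] and past [g z] costs the same
    sign. *)
Lemma dual_act_morphism (M N : rcomodule C) (g : rcomodule_hom M N) Phi x :
  g (dual_act (@rcomodule_coact _ _ M) Phi x) = dual_act (@rcomodule_coact _ _ N) Phi (g x).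
Proof.
have [gL gd gw] := rcomodule_map_axiom g.
rewrite /dual_act -gw /ptens_map; set Psi := map _ Phi.
have EM := @act_eval_pmultilinear K C M Psi; have EN := @act_eval_pmultilinear K C N Psi.
have GL := ptens_map_pmultilinear C gL.
rewrite -/(@act_eval K C M Psi) -/(@act_eval K C N Psi).
elim/ptens_ind: (rcomodule_coact _ x) => [|a z s t IH].
  by rewrite (lin0 (plift_linear GL)) (lin0 (plift_linear EM)) (lin0 (plift_linear EN)) lin0.
rewrite (plift_linear EM) (plift_linear GL) (plift_linear EN) gL IH !plift_pure //.
congr (_ *: _ + _).
have EzM := @act_eval_linear K C M Psi s; have EzN := @act_eval_linear K C N Psi s.
elim/gcomp_ind: z => [|z z' ez ez'|n z hz].
- by rewrite (lin0 EzM) !(lin0 gL) (lin0 EzN).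
- by rewrite (linD _ _ EzM) !(linD _ _ gL) (linD _ _ EzN) ez ez'.
by rewrite (act_evalE _ _ hz) (act_evalE _ _ (gd _ _ hz)) (linZ _ _ gL).
Qed.

Lemma pairing_act_morphism (M N : rcomodule C) (g : rcomodule_hom M N) :
  is_lmodule_hom (pairing_act f M) (pairing_act f N) g.
Proof.
have [gL gd _] := rcomodule_map_axiom g; split=> // s x.
rewrite /pairing_act /restrict (lin_sum _ _ _ gL); apply: eq_bigr => l _.
rewrite (lin_sum _ _ _ gL); apply: eq_bigr => i _.
by rewrite (linZ _ _ gL) dual_act_morphism.
Qed.
End Functor.

Theorem theorem8p2 (K : fieldType) (C : ainf_coalg K) (A : ainf_alg K)
    (f : pairing C A) :
  exists (iota_obj : forall M : rcomodule C, is_lmodule (pairing_act f M))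
         (iota_mor : forall (M N : rcomodule C) (g : rcomodule_hom M N),
            is_lmodule_hom (pairing_act f M) (pairing_act f N) g),
    @is_functor (rcomodule_category C) (lmodule_category A)
      (fun M => Lmodule (iota_obj M))
      (fun M N g => @LmoduleHom K A (Lmodule (iota_obj M)) (Lmodule (iota_obj N))
                      g (iota_mor M N g)).
Proof.
exists (pairing_act_lmodule f), (pairing_act_morphism f).
(* The functor keeps the underlying maps, and a module morphism is determined by its underlying
   map. *)
by split=> *; apply: lmodule_hom_ext.
Qed.
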